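(* Let $\gamma(k,r)=(k,3r)$ and let $\mathrm{Id}$ be the identity on $\mathbb R^{\mathrm{op}}\times\mathbb R$. For $X$ a non-empty, finite subset of a good metric space, the normalized degree-Čech bifiltration $\mathcal{D\check C}(X)$ and the normalized subdivision-Čech bifiltration $\mathcal{S\check C}(X)$ are $(\gamma,\mathrm{Id})$-homotopy interleaved.
   Context: A metric space is good if the intersection of any finite collection of open balls is either empty or contractible. $B(x,r)$ denotes the open ball of radius $r$ centered at $x$. **Bifiltrations.** $J=(0,\infty)^{\mathrm{op}}\times(0,\infty)$, so $(k,r)\le(k',r')$ iff $k\ge k'$ and $r\le r'$. The bifiltrations below are functors from $J$ to topological spaces with internal maps inclusions; simplicial complexes are regarded as spaces via geometric realization. - For $X$ a subset of a metric space $Z$, the Čech complex $\check{\mathcal C}(X)_r$ is the nerve of the balls $B(x,r)\subset Z$, $x\in X$: its vertex set is $X$ (balls are indexed by their centers), and its simplices are the non-empty finite $\sigma\subset X$ with $\bigcap_{x\in\sigma}B(x,r)\ne\emptyset$. - For a simplicial complex $T$ and $k>0$, $\mathcal D(T)_k$ is the maximum subcomplex of $T$ all of whose vertices have degree at least $k-1$ in the 1-skeleton of $T$; $\mathcal S(T)_k$ is the subcomplex of the barycentric subdivision of $T$ (whose simplices are flags $\sigma_1\subsetneq\cdots\subsetneq\sigma_m$ of simplices of $T$) consisting of flags whose minimum element $\sigma_1$ has dimension at least $k-1$. - For $X$ non-empty finite, $\mathcal{D\check C}(X)_{(k,r)}=\mathcal D(\check{\mathcal C}(X)_r)_{k|X|}$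 and $\mathcal{S\check C}(X)_{(k,r)}=\mathcal S(\check{\mathcal C}(X)_r)_{k|X|}$. **Interleavings.** A forward shift is a poset automorphism $\gamma$ of $\mathbb R^{\mathrm{op}}\times\mathbb R$ (ordered by $(a,b)\le(c,d)$ iff $a\ge c$ and $b\le d$) with $x\le\gamma(x)$ for all $x\in J$. For forward shifts $\gamma,\kappa$, the thin category $\mathbf I^{\gamma,\kappa}$ has objects $J\times\{0,1\}$ and a morphism $(r,i)\to(s,j)$ iff: $i=j$ and $r\le s$; or $i=0,j=1$ and $\gamma(r)\le s$; or $i=1,j=0$ and $\kappa(r)\le s$. Functors $F,G:J\to\mathbf{Top}$ are $(\gamma,\kappa)$-interleaved if there is a functor $\mathbf I^{\gamma,\kappa}\to\mathbf{Top}$ restricting to $F$ on $J\times\{0\}$ and to $G$ on $J\times\{1\}$. Functors $J\to\mathbf{Top}$ are weakly equivalent if they are connected by a finite zigzag of natural transformations each of which is objectwise a weak homotopy equivalence. $F,G$ are $(\gamma,\kappa)$-homotopy interleaved if there are $F'$ weakly equivalent to $F$ and $G'$ weakly equivalent to $G$ with $F',G'$ $(\gamma,\kappa)$-interleaved. *)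

(* Defs.v *)
From HB Require Import structures.
From mathcomp Require Import all_boot all_order all_algebra finmap.
From mathcomp Require Import all_classical all_reals all_analysis.

Set Implicit Arguments.
Unset Strict Implicit.
Unset Printing Implicit Defensive.

Import Order.TTheory GRing.Theory Num.Theory.
Import numFieldNormedType.Exports.

Local Open Scope classical_set_scope.
Local Open Scope ring_scope.

Section Homotopy.
Context (R : realType).

Definition homotopic_rel (S T : topologicalType) (A : set S) (f g : S -> T) :=
  exists H : S * R -> T,
    [/\ {within [set: S] `*` `[0, 1], continuous H},
        forall x, H (x, 0) = f x,
        forall x, H (x, 1) = g x &
        forall x t, A x -> 0 <= t <= 1 -> H (x, t) = f x].

Definition contractible (T : topologicalType) : Prop :=
  exists c : T, homotopic_rel set0 (@id T) (fun=> c).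

Definition path_joined (T : topologicalType) (x y : T) : Prop :=
  exists p : R -> T, [/\ {within `[0, 1], continuous p}, p 0 = x & p 1 = y].

(* The quotient of P by the equivalence relation e, as a set of classes, and *)
(* the map between quotients induced by h.                                   *)
Definition quotient_set (U : Type) (P : set U) (e : U -> U -> Prop) : set (set U) :=
  [set [set y | P y /\ e x y] | x in P].

Definition induced (U V : Type) (Q : set V) (e : V -> V -> Prop) (h : U -> V)
    (C : set U) : set V :=
  [set y | Q y /\ exists2 x, C x & e (h x) y].

Definition cube (n : nat) : set 'rV[R]_n :=
  [set x | forall i, 0 <= x ord0 i <= 1].
Arguments cube n : clear implicits.

Definition cube_boundary (n : nat) : set (set_type (cube n)) :=
  [set x | exists i, (set_val x : 'rV_n) ord0 i = 0 \/
                     (set_val x : 'rV_n) ord0 i = 1].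

Definition spheroids (n : nat) (T : topologicalType) (a : T) :
    set (set_type (cube n) -> T) :=
  [set u | continuous u /\ forall x, cube_boundary x -> u x = a].
Arguments spheroids n {T} a.

Definition pi0 (T : topologicalType) : set (set T) :=
  quotient_set [set: T] (@path_joined T).

Definition pi0_map (S T : topologicalType) (f : S -> T) : set S -> set T :=
  induced [set: T] (@path_joined T) f.

Definition pi_n (n : nat) (T : topologicalType) (a : T) :
    set (set (set_type (cube n) -> T)) :=
  quotient_set (spheroids n a) (homotopic_rel (@cube_boundary n)).
Arguments pi_n n {T} a.

Definition pi_n_map (n : nat) (S T : topologicalType) (f : S -> T) (a : S) :
    set (set_type (cube n) -> S) -> set (set_type (cube n) -> T) :=
  induced (spheroids n (f a)) (homotopic_rel (@cube_boundary n))
          (fun u => f \o u).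
Arguments pi_n_map n {S T} f a.

(* The maps induced on the groups pi_n, n >= 1, are group morphisms, hence   *)
(* are isomorphisms as soon as they are bijective.                           *)
Definition weak_homotopy_equivalence (S T : topologicalType) (f : S -> T) :=
  [/\ continuous f,
      set_bij (@pi0 S) (@pi0 T) (pi0_map f) &
      forall (n : nat) (a : S), (0 < n)%N ->
        set_bij (pi_n n a) (pi_n n (f a)) (pi_n_map n f a)].

(* The empty collection of balls is excluded: Z itself need not be           *)
(* contractible.                                                             *)
Definition good (Z : metricType R) : Prop :=
  forall s : seq (Z * R), s != [::] ->
    let U := \bigcap_(b in [set` s]) ball b.1 b.2 in
    U = set0 \/ contractible (set_type U).

End Homotopy.

(* Functors from a preorder, seen as a thin category, to topological spaces. *)
Record functor (d : Order.disp_t) (I : preorderType d) := Functor {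
  fobj :> I -> topologicalType;
  fmap : forall x y : I, (x <= y)%O -> fobj x -> fobj y;
  fmap_continuous : forall (x y : I) (xy : (x <= y)%O), continuous (@fmap _ _ xy);
  fmap_id : forall (x : I) (xx : (x <= x)%O) p, fmap xx p = p;
  fmap_comp : forall (x y z : I) (xy : (x <= y)%O) (yz : (y <= z)%O)
    (xz : (x <= z)%O) p, fmap xz p = fmap yz (fmap xy p)
}.
Arguments fmap {d I} f {x y} xy.

Record nat_trans (d : Order.disp_t) (I : preorderType d) (F G : functor I) :=
  NatTrans {
    component :> forall x : I, F x -> G x;
    component_continuous : forall x, continuous (@component x);
    naturality : forall (x y : I) (xy : (x <= y)%O) p,
      @component y (fmap F xy p) = fmap G xy (@component x p)
  }.
Arguments component {d I F G} eta x : rename.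

Program Definition restrict (d d' : Order.disp_t) (I : preorderType d)
    (I' : preorderType d') (h : I -> I') (h_homo : {homo h : x y / (x <= y)%O})
    (F : functor I') : functor I :=
  @Functor d I (fun x => F (h x)) (fun x y xy => fmap F (h_homo x y xy)) _ _ _.
Next Obligation. by move=> *; exact: fmap_continuous. Qed.
Next Obligation. by move=> *; exact: fmap_id. Qed.
Next Obligation. by move=> *; exact: fmap_comp. Qed.

Section WeakEquivalence.
Context (R : realType) (d : Order.disp_t) (I : preorderType d).

Definition objectwise_weak_equivalence (F G : functor I) : Prop :=
  exists eta : nat_trans F G, forall x, weak_homotopy_equivalence R (eta x).

Inductive weakly_equivalent (F : functor I) : functor I -> Prop :=
| weakly_equivalent_refl : weakly_equivalent F F
| weakly_equivalent_forward G H : weakly_equivalent F G ->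
    objectwise_weak_equivalence G H -> weakly_equivalent F H
| weakly_equivalent_backward G H : weakly_equivalent F G ->
    objectwise_weak_equivalence H G -> weakly_equivalent F H.

End WeakEquivalence.

Section InclusionFunctor.
Context (E : topologicalType).

Definition set_inclusion (A B : set E) (AB : A `<=` B) (p : set_type A) :
    set_type B :=
  SigSub (mem_set (AB _ (set_mem (valP p)))).

Lemma set_inclusion_continuous (A B : set E) (AB : A `<=` B) :
  continuous (set_inclusion AB).
Proof.
apply: continuous_comp_initial => x.
have -> : set_val \o set_inclusion AB = set_val by apply: funext => y.
exact: initial_continuous.
Qed.

Program Definition inclusion_functor (d : Order.disp_t) (I : preorderType d)
    (A : I -> set E) (A_mono : forall x y, (x <= y)%O -> A x `<=` A y) :
    functor I :=
  @Functor d I (fun x => set_type (A x))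
    (fun x y xy => set_inclusion (A_mono x y xy)) _ _ _.
Next Obligation. by move=> *; exact: set_inclusion_continuous. Qed.
Next Obligation. by move=> *; exact: val_inj. Qed.
Next Obligation. by move=> *; exact: val_inj. Qed.

End InclusionFunctor.


(* All simplicial complexes are finite here. V is the type of potential      *)
(* vertices: the vertices are the v such that {v} is a simplex.              *)
Record simplicial_complex (V : finType) := SimplicialComplex {
  simplices :> {set {set V}};
  simplex_neq0 : forall s, s \in simplices -> s != finset.set0;
  simplex_face : forall s t : {set V},
    s \in simplices -> t \subset s -> t != finset.set0 -> t \in simplices
}.

Section Complexes.
Context (R : realType) (V : finType).
Implicit Types T : simplicial_complex V.

(* The geometric realization, in barycentric coordinates.                    *)
Definition realization T : set {ptws V -> R} :=
  [set w | [/\ forall v, 0 <= w v, \sum_v w v = 1 &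
               [set v | w v != 0]%SET \in simplices T]].

Lemma realization_sub T T' : T \subset T' -> realization T `<=` realization T'.
Proof. by move=> /fintype.subsetP TT' w [w0 w1 wT]; split=> //; exact: TT'. Qed.

Definition dim (s : {set V}) : nat := #|s|.-1.

Definition degree T (v : V) : nat :=
  #|[set u | (u != v) && ([set u; v]%SET \in simplices T)]%SET|.

Definition degree_simplices T (k : R) : {set {set V}} :=
  [set s in simplices T | [forall v in s, k - 1 <= (degree T v)%:R]]%SET.

Program Definition degree_complex T (k : R) : simplicial_complex V :=
  @SimplicialComplex V (degree_simplices T k) _ _.
Next Obligation.
by move=> T k s; rewrite finset.inE => /andP[/simplex_neq0].
Qed.
Next Obligation.
move=> T k s t; rewrite !finset.inE => /andP[sT /forall_inP sk] ts t0.
rewrite (simplex_face sT ts t0); apply/forall_inP => v vt.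
by apply: sk; exact: (fintype.subsetP ts).
Qed.

(* degree_complex T k is the maximum subcomplex of T all of whose vertices   *)
(* have degree at least k - 1 in T.                                          *)
Lemma degree_complex_sub T k : degree_complex T k \subset T.
Proof. by apply/fintype.subsetP => s; rewrite finset.inE => /andP[]. Qed.

Lemma degree_complex_vertex T k v :
  [set v]%SET \in simplices (degree_complex T k) -> k - 1 <= (degree T v)%:R.
Proof.
by rewrite finset.inE => /andP[_ /forall_inP]; apply; rewrite finset.inE.
Qed.

Lemma degree_complex_max T (T' : simplicial_complex V) k :
    T' \subset T ->
    (forall v, [set v]%SET \in simplices T' -> k - 1 <= (degree T v)%:R) ->
  T' \subset degree_complex T k.
Proof.
move=> /fintype.subsetP T'T T'k; apply/fintype.subsetP => s sT'; rewrite finset.inE T'T//=.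
apply/forall_inP => v vs; apply/T'k/(simplex_face sT').
  by rewrite finset.sub1set.
by apply/finset.set0Pn; exists v; rewrite finset.inE.
Qed.

(* The flags of simplices of T whose minimum element has dimension >= k - 1. *)
Definition subdivision_simplices T (k : R) : {set {set {set V}}} :=
  [set F : {set {set V}} |
    [&& F \subset T,
        [forall s in F, forall t in F, (s \subset t) || (t \subset s)] &
        [exists s in F, [forall t in F, s \subset t] &&
                        (k - 1 <= (dim s)%:R)]]]%SET.

Program Definition subdivision_complex T (k : R) :
    simplicial_complex {set V} :=
  @SimplicialComplex {set V} (subdivision_simplices T k) _ _.
Next Obligation.
move=> T k F; rewrite finset.inE => /and3P[_ _ /exists_inP[s sF _]].
by apply/finset.set0Pn; exists s.
Qed.
Next Obligation.
move=> T k F G; rewrite !finset.inE => /and3P[FT /forall_inP Fch].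
move=> /exists_inP[m mF /andP[/forall_inP mmin km]] GF /finset.set0Pn[s0 s0G].
have GFP := fintype.subsetP GF.
have Gch s t : s \in G -> t \in G -> (s \subset t) || (t \subset s).
  by move=> sG tG; apply: (forall_inP (Fch _ (GFP _ sG))); exact: GFP.
apply/and3P; split; first exact: fintype.subset_trans FT.
  by apply/forall_inP => s sG; apply/forall_inP => t; exact: Gch.
have [m' m'G m'min] := arg_minnP (fun s : {set V} => #|s|) s0G.
apply/exists_inP; exists m' => //; apply/andP; split.
  apply/forall_inP => t tG; have /orP[//|tm'] := Gch _ _ m'G tG.
  have /eqP -> // : t == m' by rewrite finset.eqEcard tm' m'min.
apply: le_trans km _; rewrite ler_nat /dim -!subn1 leq_sub2r//.
exact/subset_leq_card/mmin/GFP.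
Qed.

Lemma degree_complex_mono T T' (k k' : R) : T \subset T' -> k' <= k ->
  degree_complex T k \subset degree_complex T' k'.
Proof.
move=> TT' k'k; have TT'P := fintype.subsetP TT'.
apply/fintype.subsetP => s; rewrite !finset.inE => /andP[sT /forall_inP sk].
rewrite TT'P//=; apply/forall_inP => v /sk kv.
apply: le_trans (lerB k'k (lexx 1)) (le_trans kv _); rewrite ler_nat.
apply/subset_leq_card/fintype.subsetP => u; rewrite !finset.inE.
by move=> /andP[-> /TT'P].
Qed.

Lemma subdivision_complex_mono T T' (k k' : R) : T \subset T' -> k' <= k ->
  subdivision_complex T k \subset subdivision_complex T' k'.
Proof.
move=> TT' k'k; apply/fintype.subsetP => F; rewrite !finset.inE.
move=> /and3P[FT -> /exists_inP[s sF /andP[smin ks]]] /=.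
rewrite (fintype.subset_trans FT TT')/=; apply/exists_inP; exists s => //.
by rewrite smin; apply: le_trans ks; rewrite lerB.
Qed.

End Complexes.
Arguments realization R {V} T.

Section Interleavings.
Context (R : realType).

(* R^op x R, with first coordinate k and second coordinate r.                *)
Definition plane := (R^d *p R)%type.

Definition in_quadrant : pred plane :=
  fun p => ((0 : R) < p.1) && ((0 : R) < p.2).

(* The poset J = (0, oo)^op x (0, oo).                                       *)
Definition quadrant := {p : plane | in_quadrant p}.

HB.instance Definition _ := SubType.on quadrant.
HB.instance Definition _ := Choice.on quadrant.
HB.instance Definition _ :=
  [SubChoice_isSubPOrder of quadrant by <: with (Order.Disp tt tt)].

Lemma quadrant_leE (x y : quadrant) : (x <= y)%O =
  (((val y).1 : R) <= (val x).1) && (((val x).2 : R) <= (val y).2).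
Proof. by []. Qed.

Record forward_shift := ForwardShift {
  shift_fun :> plane -> plane;
  shift_bij : bijective shift_fun;
  shift_mono : {mono shift_fun : x y / (x <= y)%O};
  shift_ge : forall x : quadrant, (val x <= shift_fun (val x))%O
}.

Section InterleavingCategory.
Context (gamma kappa : forward_shift).

(* The thin category I^(gamma, kappa); false and true stand for 0 and 1.     *)
Definition interleaving_category : Type := (quadrant * bool)%type.

Definition interleaving_le (x y : interleaving_category) : bool :=
  let: (r, i) := x in let: (s, j) := y in
  match i, j with
  | false, true => (gamma (val r) <= val s)%O
  | true, false => (kappa (val r) <= val s)%O
  | _, _ => (r <= s)%O
  end.

Lemma interleaving_le_refl : reflexive interleaving_le.
Proof. by move=> [r []] /=. Qed.

Lemma interleaving_le_trans : transitive interleaving_le.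
Proof.
have up (g : forward_shift) (r s : quadrant) :
    (g (val r) <= val s)%O -> (val r <= val s)%O.
  exact: le_trans (shift_ge g r).
have two (g h : forward_shift) (s r t : quadrant) :
    (g (val r) <= val s)%O -> (h (val s) <= val t)%O -> (val r <= val t)%O.
  by move=> /up rs /up; apply: le_trans.
have shift (g : forward_shift) (s r t : quadrant) :
    (r <= s)%O -> (g (val s) <= val t)%O -> (g (val r) <= val t)%O.
  by move=> rs; apply: le_trans; rewrite shift_mono.
have shift' (g : forward_shift) (s r t : quadrant) :
    (g (val r) <= val s)%O -> (s <= t)%O -> (g (val r) <= val t)%O.
  by move=> gs st; apply: le_trans gs _.
move=> [s [|]] [r [|]] [t [|]] /=.
- exact: le_trans.
- exact: shift.
- exact: shift'.
- exact: two.
- exact: two.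
- exact: shift'.
- exact: shift.
- exact: le_trans.
Qed.

HB.instance Definition _ := Choice.on interleaving_category.
HB.instance Definition _ := Order.Le_isPreorder.Build (Order.Disp tt tt)
  interleaving_category interleaving_le_refl interleaving_le_trans.

Lemma interleaving_leE (x y : interleaving_category) :
  (x <= y)%O = interleaving_le x y.
Proof. by []. Qed.

Definition at0 (r : quadrant) : interleaving_category := (r, false).
Definition at1 (r : quadrant) : interleaving_category := (r, true).

Lemma at0_homo : {homo at0 : r s / (r <= s)%O}.
Proof. by []. Qed.

Lemma at1_homo : {homo at1 : r s / (r <= s)%O}.
Proof. by []. Qed.

Definition interleaved (F G : functor quadrant) : Prop :=
  exists H : functor interleaving_category,
    restrict at0_homo H = F /\ restrict at1_homo H = G.

Definition homotopy_interleaved (F G : functor quadrant) : Prop :=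
  exists F' G', [/\ weakly_equivalent R F' F, weakly_equivalent R G' G &
                    interleaved F' G'].

End InterleavingCategory.

Program Definition id_shift : forward_shift := @ForwardShift id _ _ _.
Next Obligation. by exists id. Qed.
Next Obligation. by []. Qed.
Next Obligation. by []. Qed.

Program Definition triple_shift : forward_shift :=
  @ForwardShift (fun p : plane => (p.1, 3%:R * (p.2 : R))) _ _ _.
Next Obligation.
exists (fun p : plane => (p.1, 3%:R^-1 * (p.2 : R))) => -[k r] /=.
  by rewrite mulKf.
by rewrite mulVKf.
Qed.
Next Obligation.
move=> [k r] [k' r'] /=.
change ((((k' : R) <= k) && (3%:R * (r : R) <= 3%:R * r')) =
        (((k' : R) <= k) && ((r : R) <= r'))).
by rewrite ler_pM2l.
Qed.
Next Obligation.
move=> [[k r] /= /andP[_ /= r0]].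
change (((k : R) <= k) && ((r : R) <= 3%:R * r)).
by rewrite lexx /= ler_peMl ?(ler1n R 3) ?(ltW r0).
Qed.

End Interleavings.

Section Cech.
Context (R : realType) (Z : metricType R) (X : {fset Z}).

Definition cech_simplices (r : R) : {set {set X}} :=
  [set s : {set X} | (s != finset.set0) &&
    `[< \bigcap_(x in [set` s]) ball (val x) r !=set0 >]]%SET.

Program Definition cech (r : R) : simplicial_complex X :=
  @SimplicialComplex _ (cech_simplices r) _ _.
Next Obligation. by move=> r s; rewrite finset.inE => /andP[]. Qed.
Next Obligation.
move=> r s t; rewrite !finset.inE => /andP[_ /asboolP[z sz]] ts t0.
by rewrite t0; apply/asboolP; exists z => x xt; apply/sz/(fintype.subsetP ts).
Qed.

Lemma cech_mono (r r' : R) : r <= r' -> cech r \subset cech r'.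
Proof.
move=> rr'; apply/fintype.subsetP => s; rewrite !finset.inE.
move=> /andP[-> /asboolP[z sz]]; apply/asboolP; exists z => x xs.
exact: le_ball rr' _ (sz x xs).
Qed.

(* The normalized bifiltrations.                                             *)
Definition degree_cech_complex (p : quadrant R) : simplicial_complex X :=
  degree_complex (cech (val p).2) (((val p).1 : R) * #|` X|%:R).

Definition subdivision_cech_complex (p : quadrant R) :
    simplicial_complex {set X} :=
  subdivision_complex (cech (val p).2) (((val p).1 : R) * #|` X|%:R).

Lemma degree_cech_mono (p q : quadrant R) : (p <= q)%O ->
  realization R (degree_cech_complex p) `<=`
  realization R (degree_cech_complex q).
Proof.
rewrite quadrant_leE => /andP[k_le r_le]; apply/realization_sub.
by apply: degree_complex_mono; [exact: cech_mono | exact: ler_wpM2r].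
Qed.

Lemma subdivision_cech_mono (p q : quadrant R) : (p <= q)%O ->
  realization R (subdivision_cech_complex p) `<=`
  realization R (subdivision_cech_complex q).
Proof.
rewrite quadrant_leE => /andP[k_le r_le]; apply/realization_sub.
by apply: subdivision_complex_mono; [exact: cech_mono | exact: ler_wpM2r].
Qed.

Definition degree_cech : functor (quadrant R) :=
  inclusion_functor degree_cech_mono.

Definition subdivision_cech : functor (quadrant R) :=
  inclusion_functor subdivision_cech_mono.

End Cech.

(* Main.v *)
Require Import Defs.
From mathcomp Require Import all_boot all_order all_algebra finmap.
From mathcomp Require Import all_classical all_reals all_analysis.
From mathcomp Require Import lra.

(* The interleaving is built between witness complexes, whose vertices stand *)
(* for points of Z: U(k, r) consists of the finite sets of points contained  *)
(* in one ball B(x, r) whose centre has degree >= k|X| - 1 in the Cech       *)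
(* complex, and M(k, r) of those contained in k|X| common balls of radius r. *)
(* Then M(k, r) is contained in U(k, r), and U(k, r) in M(k, 3r) because a   *)
(* point of B(x, r) is within 3r of all the neighbours of x.  By Dowker      *)
(* duality U is equivalent to the degree-Cech and M to the subdivision-Cech  *)
(* bifiltration.  Only finitely many points, indexed by the subsets of X,    *)
(* are used, so that all complexes are finite.                               *)
(* Duality takes the form of a Galois connection between the faces of a      *)
(* complex T and a poset Q: then T and the order complex of Q are both       *)
(* strong deformation retracts of one complex, which contains their disjoint *)
(* union.  These inclusions are natural on the nose, and, being strong       *)
(* deformation retracts, they are weak equivalences without any change of    *)
(* base point.                                                               *)

Set Implicit Arguments.
Unset Strict Implicit.
Unset Printing Implicit Defensive.

Import Order.TTheory GRing.Theory Num.Theory.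
Import numFieldNormedType.Exports.

Local Open Scope classical_set_scope.
Local Open Scope ring_scope.

(** * Homotopies *)

(** Both bifiltrations are replaced by complexes whose simplices are finite sets of points of Z;
    there the comparison becomes an inclusion. A simplex with many vertices gives each of them high
    degree at the same scale ([large_degree_simplices]). Conversely, a point of B(x, r) is within 3r
    of every neighbour of x, so x and its neighbours span one large simplex at scale 3r
    ([near_triple], [degree_witness_large]).

    The passage to points is Dowker duality ([galois_witness]): a set of points corresponds to the
    largest admissible simplex all of whose balls contain it. Thus [large_witness] is equivalent to
    the flags of large simplices, which form the subdivision complex, and [degree_witness] to the
    flags of the degree complex, which form its barycentric subdivision.

    Each duality is realised by two flows on barycentric coordinates ([flag_flow_deformation],
    [layer_flow_deformation]). A flow only has to keep supports simplices, since its values are then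
    normalised ([deformation_flow_weak_equivalence]); as it fixes the subcomplex pointwise, it
    yields bijections on all homotopy groups ([retract_weak_homotopy_equivalence]). *)

Section Continuity.
Context (R : realType).

Lemma continuous_ptws (S : topologicalType) (V : eqType) (f : S -> {ptws V -> R}) :
  (forall v, continuous (fun x => f x v)) -> continuous f.
Proof.
move=> fc x; apply/cvg_sup => v.
exact: (@continuous_comp_initial _ _ _ (fun w : V -> R => w v) f (fc v)).
Qed.

Lemma continuous_coord (S : topologicalType) (V : eqType) (f : S -> {ptws V -> R}) v :
  continuous f -> continuous (fun x => f x v).
Proof.
move=> fc x; apply: (@continuous_comp _ _ _ f (@proj V (fun=> R) v)).
  exact: fc.
exact: proj_continuous.
Qed.

Lemma continuous_set_type (S E : topologicalType) (A : set E) (f : S -> set_type A) :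
  continuous (fun x => set_val (f x)) -> continuous f.
Proof. exact: continuous_comp_initial. Qed.

Lemma continuous_set_val (E : topologicalType) (A : set E) :
  continuous (set_val : set_type A -> E).
Proof. exact: initial_continuous. Qed.

Lemma maxr_continuous (S : topologicalType) (f g : S -> R) :
  continuous f -> continuous g -> continuous (fun x => Num.max (f x) (g x)).
Proof. by move=> fc gc x; exact: continuous_max (fc x) (gc x). Qed.

Lemma minr_continuous (S : topologicalType) (f g : S -> R) :
  continuous f -> continuous g -> continuous (fun x => Num.min (f x) (g x)).
Proof. by move=> fc gc x; exact: continuous_min (fc x) (gc x). Qed.

Lemma sumr_continuous (S : topologicalType) (I : Type) (r : seq I) (P : pred I)
    (F : I -> S -> R) :
  (forall i, P i -> continuous (F i)) ->
  continuous (fun x => \sum_(i <- r | P i) F i x).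
Proof. by apply: continuous_big => x; exact: add_continuous. Qed.

Lemma prodr_continuous (S : topologicalType) (I : Type) (r : seq I) (P : pred I)
    (F : I -> S -> R) :
  (forall i, P i -> continuous (F i)) ->
  continuous (fun x => \prod_(i <- r | P i) F i x).
Proof. by apply: continuous_big => x; exact: mul_continuous. Qed.

Lemma addr_continuous (S : topologicalType) (f g : S -> R) :
  continuous f -> continuous g -> continuous (fun x => f x + g x).
Proof. by move=> fc gc x; exact: cvgD (fc x) (gc x). Qed.

Lemma subr_continuous (S : topologicalType) (f g : S -> R) :
  continuous f -> continuous g -> continuous (fun x => f x - g x).
Proof. by move=> fc gc x; exact: cvgB (fc x) (gc x). Qed.

Lemma mulr_continuous (S : topologicalType) (f g : S -> R) :
  continuous f -> continuous g -> continuous (fun x => f x * g x).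
Proof. by move=> fc gc x; exact: cvgM (fc x) (gc x). Qed.

Lemma divr_continuous (S : topologicalType) (f g : S -> R) :
  (forall x, g x != 0) ->
  continuous f -> continuous g -> continuous (fun x => f x / g x).
Proof. by move=> g0 fc gc x; apply: cvgM (fc x) _; exact: cvgV (g0 x) (gc x). Qed.

Definition clip (t : R) : R := Num.max 0 (Num.min t 1).

Lemma clip_itv t : 0 <= clip t <= 1.
Proof. by rewrite /clip le_max lexx ge_max ler01 ge_min lexx orbT. Qed.

Lemma clip_id t : 0 <= t <= 1 -> clip t = t.
Proof. by case/andP=> t0 t1; rewrite /clip min_l// max_r. Qed.

Lemma clip_continuous : continuous clip.
Proof.
apply: maxr_continuous; first exact: cst_continuous.
by apply: minr_continuous; [by move=> x; exact: cvg_id | exact: cst_continuous].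
Qed.

Lemma continuous_fst (S T : topologicalType) : continuous (@fst S T).
Proof. by move=> x; exact: cvg_fst. Qed.

Lemma continuous_snd (S T : topologicalType) : continuous (@snd S T).
Proof. by move=> x; exact: cvg_snd. Qed.

Lemma continuous_pair (S T U : topologicalType) (f : U -> S) (g : U -> T) :
  continuous f -> continuous g -> continuous (fun x => (f x, g x)).
Proof. by move=> fc gc x; exact: cvg_pair (fc x) (gc x). Qed.

Lemma continuous_compose (S T U : topologicalType) (f : S -> T) (g : T -> U) :
  continuous f -> continuous g -> continuous (g \o f).
Proof. by move=> fc gc x; exact: continuous_comp (fc x) (gc _). Qed.

End Continuity.

(** * Relative homotopies and strong deformation retracts *)

Section Homotopies.
Context (R : realType).
Implicit Types S T : topologicalType.

Lemma within_comp_continuous S T (U : topologicalType) (A : set T) (h : S -> T)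
    (f : T -> U) :
  {within A, continuous f} -> continuous h -> (forall x, A (h x)) ->
  continuous (f \o h).
Proof.
move=> /subspace_continuousP fc hc hA x.
apply: cvg_comp (fc _ (hA x)) => P /= PA.
apply: (@filterS _ _ _ (h @^-1` [set y | A y -> P y])) (hc x _ PA) => y.
exact.
Qed.

(** Clipping the time extends a homotopy to all of [S * R], so that later constructions avoid the
    subspace topology of the strip. *)
Lemma homotopic_relP S T (A : set S) (f g : S -> T) :
  homotopic_rel R A f g <->
  exists H : S * R -> T,
    [/\ continuous H, forall x, H (x, 0) = f x, forall x, H (x, 1) = g x &
        forall x t, A x -> H (x, t) = f x].
Proof.
split=> -[H [Hc H0 H1 HA]]; last first.
  by exists H; split=> // [|x t /HA //]; exact: continuous_subspaceT.
exists (H \o (fun z => (z.1, clip z.2))); split=> /=.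
- apply: within_comp_continuous Hc _ _ => [|x /=]; last by split=> //=; rewrite in_itv/= clip_itv.
  apply: continuous_pair; first exact: continuous_fst.
  by apply: continuous_compose; [exact: continuous_snd | exact: clip_continuous].
- by move=> x; rewrite clip_id ?lexx ?ler01.
- by move=> x; rewrite clip_id ?lexx ?ler01.
- by move=> x t Ax; apply: HA => //; exact: clip_itv.
Qed.

Lemma homotopic_rel_refl S T (A : set S) (f : S -> T) :
  continuous f -> homotopic_rel R A f f.
Proof.
move=> fc; apply/homotopic_relP; exists (f \o fst); split=> //.
by apply: continuous_compose fc; exact: continuous_fst.
Qed.

Lemma homotopic_rel_sym S T (A : set S) (f g : S -> T) :
  homotopic_rel R A f g -> homotopic_rel R A g f.
Proof.
move=> /homotopic_relP[H [Hc H0 H1 HA]]; apply/homotopic_relP.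
exists (H \o (fun z => (z.1, 1 - z.2))); split=> /=.
- apply: continuous_compose Hc; apply: continuous_pair; first exact: continuous_fst.
  by apply: subr_continuous; [exact: cst_continuous | exact: continuous_snd].
- by move=> x; rewrite subr0.
- by move=> x; rewrite subrr.
- by move=> x t Ax; rewrite HA// -H1 HA.
Qed.

Lemma homotopic_rel_trans S T (A : set S) (f g h : S -> T) :
  homotopic_rel R A f g -> homotopic_rel R A g h -> homotopic_rel R A f h.
Proof.
move=> /homotopic_relP[H [Hc H0 H1 HA]] /homotopic_relP[K [Kc K0 K1 KA]].
apply/homotopic_relP.
have cc (a b : R) : continuous (fun z : S * R => (z.1, clip (a * z.2 + b))).
  apply: continuous_pair; first exact: continuous_fst.
  apply: (@continuous_compose _ _ _ (fun z : S * R => a * z.2 + b) _ _ (@clip_continuous R)).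
  apply: addr_continuous; last exact: cst_continuous.
  by apply: mulr_continuous; [exact: cst_continuous | exact: continuous_snd].
pose H' := H \o (fun z => (z.1, clip (2 * z.2 + 0))).
pose K' := K \o (fun z => (z.1, clip (2 * z.2 + (- 1)))).
pose L (z : S * R) := if z.2 <= 2^-1 then H' z else K' z.
exists L; split.
(* Pasting along two closed halves; at time 1/2 both pieces equal g. *)
- have sndc := (continuous_closedP (@snd S R)).1 (@continuous_snd _ _).
  have Lc : {within [set z : S * R | z.2 <= 2^-1] `|` [set z | 2^-1 <= z.2],
      continuous L}.
    apply: withinU_continuous.
    + exact: sndc _ (@closed_le _ _).
    + exact: sndc _ (@closed_ge _ _).
    + apply: (@subspace_eq_continuous _ _ _ H').
        by move=> z /set_mem z2; rewrite /from_subspace /L ifT.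
      by apply: continuous_subspaceT; exact: continuous_compose (cc _ _) Hc.
    + apply: (@subspace_eq_continuous _ _ _ K').
        move=> z /set_mem /= z2; rewrite /from_subspace /L; case: ifPn => // z2'.
        have {z2'}z2 : z.2 = 2^-1 by apply/eqP; rewrite eq_le z2 z2'.
        rewrite /H' /K' /= z2 divff// addr0 subrr.
        by rewrite !clip_id ?lexx ?ler01// K0 H1.
      by apply: continuous_subspaceT; exact: continuous_compose (cc _ _) Kc.
  apply/continuous_subspace_setT.
  rewrite (_ : setT = [set z : S * R | z.2 <= 2^-1] `|` [set z | 2^-1 <= z.2])//.
  by apply/seteqP; split=> // z _ /=; case: (leP z.2 2^-1) => [|/ltW]; [left|right].
- by move=> x; rewrite /L /= invr_ge0 ler0n /H' /= mulr0 addr0 clip_id ?lexx ?ler01.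
- move=> x; rewrite /L /= ifF; last by apply/negbTE; rewrite -ltNge; lra.
  by rewrite /K' /= clip_id; [rewrite -[RHS]K1; congr (K (_, _)); lra | lra].
- move=> x t Ax; rewrite /L /=; case: ifPn => _; rewrite /H' /K' /= ?HA// KA//.
  by rewrite -H1 HA.
Qed.

Lemma homotopic_rel_postcomp S T (U : topologicalType) (A : set S)
    (f g : S -> T) (h : T -> U) :
  continuous h -> homotopic_rel R A f g -> homotopic_rel R A (h \o f) (h \o g).
Proof.
move=> hc /homotopic_relP[H [Hc H0 H1 HA]]; apply/homotopic_relP.
exists (h \o H); split=> /=.
- exact: continuous_compose Hc hc.
- by move=> x; rewrite H0.
- by move=> x; rewrite H1.
- by move=> x t Ax; rewrite HA.
Qed.

Lemma homotopic_rel_precomp S T (U : topologicalType) (A : set T) (B : set S)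
    (f g : T -> U) (h : S -> T) :
  continuous h -> (forall x, B x -> A (h x)) -> homotopic_rel R A f g ->
  homotopic_rel R B (f \o h) (g \o h).
Proof.
move=> hc hBA /homotopic_relP[H [Hc H0 H1 HA]]; apply/homotopic_relP.
exists (H \o (fun z => (h z.1, z.2))); split=> /=.
- apply: continuous_compose Hc; apply: continuous_pair; last exact: continuous_snd.
  by apply: continuous_compose hc; exact: continuous_fst.
- by move=> x; rewrite H0.
- by move=> x; rewrite H1.
- by move=> x t Bx; rewrite HA//; exact: hBA.
Qed.

(* Reduces the concatenation of paths to that of homotopies. *)
Lemma path_joinedP T (x y : T) :
  path_joined R x y <-> homotopic_rel R set0 (fun _ : R => x) (fun=> y).
Proof.
split=> [[p [pc p0 p1]]|/homotopic_relP[H [Hc H0 H1 _]]].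
  apply/homotopic_relP; exists ((p \o @clip R) \o snd); split=> //=.
  - apply: continuous_compose; first exact: continuous_snd.
    apply: within_comp_continuous pc _ _ => [|t /=]; first exact: clip_continuous.
    by rewrite in_itv/= clip_itv.
  - by rewrite clip_id ?lexx ?ler01.
  - by rewrite clip_id ?lexx ?ler01.
exists (fun t => H (0, t)); split=> //.
apply: continuous_subspaceT; apply: (@continuous_compose _ _ _ (fun t : R => (0, t)) H) => //.
by apply: continuous_pair; [exact: cst_continuous | move=> t; exact: cvg_id].
Qed.

(** Reduces bijectivity on sets of classes to representatives; it serves both for path components
    and for homotopy groups. *)
Lemma set_bij_induced (U V : Type) (P : set U) (Q : set V)
    (e : U -> U -> Prop) (e' : V -> V -> Prop) (h : U -> V) :
    (forall x, P x -> e x x) -> (forall x y, e x y -> e y x) ->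
    (forall x y z, e x y -> e y z -> e x z) ->
    (forall x, Q x -> e' x x) -> (forall x y, e' x y -> e' y x) ->
    (forall x y z, e' x y -> e' y z -> e' x z) ->
    (forall x, P x -> Q (h x)) ->
    (forall x y, P x -> P y -> e x y <-> e' (h x) (h y)) ->
    (forall z, Q z -> exists2 x, P x & e' (h x) z) ->
  set_bij (quotient_set P e) (quotient_set Q e') (Defs.induced Q e' h).
Proof.
move=> er es et er' es' et' hPQ hee hsurj.
have indE x : P x -> Defs.induced Q e' h [set y | P y /\ e x y] =
    [set z | Q z /\ e' (h x) z].
  move=> Px; apply/seteqP; split=> z /= [Qz].
    case=> y [Py exy] hyz; split=> //; apply: et' hyz.
    by apply/hee.
  by move=> hxz; split=> //; exists x => //; split=> //; exact: er.
split.
- by move=> _ [x Px <-]; rewrite indE//; exists (h x) => //; exact: hPQ.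
- move=> _ _ /set_mem[x Px <-] /set_mem[y Py <-]; rewrite !indE// => exy.
  have /= [_ hxy] : [set z | Q z /\ e' (h x) z] (h y).
    by rewrite exy /=; split; [exact: hPQ | apply/er'/hPQ].
  have {}hxy : e x y by apply/hee.
  apply/seteqP; split=> z /= [Pz ez]; split=> //.
    by apply: et ez; exact: es.
  exact: et ez.
- move=> _ [z Qz <-]; have [x Px hxz] := hsurj z Qz.
  exists [set y | P y /\ e x y]; first by exists x.
  rewrite indE//; apply/seteqP; split=> w /= [Qw ew]; split=> //.
    by apply: et' ew; exact: es'.
  exact: et' ew.
Qed.

(* The homotopy is relative to the image of f, so that no change of base     *)
(* point is needed.                                                          *)
Lemma retract_weak_homotopy_equivalence S T (f : S -> T) (g : T -> S) :
  continuous f -> continuous g -> cancel f g ->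
  homotopic_rel R (range f) id (f \o g) ->
  weak_homotopy_equivalence R f.
Proof.
move=> fc gc fK fg; split=> //.
  apply: set_bij_induced => //.
  - by move=> x _; apply/path_joinedP/homotopic_rel_refl; exact: cst_continuous.
  - by move=> x y /path_joinedP/homotopic_rel_sym/path_joinedP.
  - move=> x y z /path_joinedP xy /path_joinedP yz.
    by apply/path_joinedP; exact: homotopic_rel_trans yz.
  - by move=> x _; apply/path_joinedP/homotopic_rel_refl; exact: cst_continuous.
  - by move=> x y /path_joinedP/homotopic_rel_sym/path_joinedP.
  - move=> x y z /path_joinedP xy /path_joinedP yz.
    by apply/path_joinedP; exact: homotopic_rel_trans yz.
  - move=> x y _ _; split=> /path_joinedP xy; apply/path_joinedP.
      exact: (homotopic_rel_postcomp fc xy).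
    have := homotopic_rel_postcomp gc xy.
    by congr (homotopic_rel R _ _ _); apply: funext => t /=; rewrite fK.
  (* The track of z under the homotopy is a path from z to f (g z). *)
  - move=> z _; exists (g z) => //; apply/path_joinedP/homotopic_rel_sym.
    apply: (@homotopic_rel_precomp _ _ _ set0 _ id (f \o g) (fun=> z)) => //.
      exact: cst_continuous.
    have /homotopic_relP[H [Hc H0 H1 _]] := fg.
    by apply/homotopic_relP; exists H.
move=> n a _; apply: set_bij_induced => //.
- by move=> u [uc _]; exact: homotopic_rel_refl.
- by move=> u v; exact: homotopic_rel_sym.
- by move=> u v w; exact: homotopic_rel_trans.
- by move=> u [uc _]; exact: homotopic_rel_refl.
- by move=> u v; exact: homotopic_rel_sym.
- by move=> u v w; exact: homotopic_rel_trans.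
- move=> u [uc ua]; split=> [|x /ua /= ->//].
  exact: continuous_compose uc fc.
- move=> u v _ _; split=> uv; first exact: homotopic_rel_postcomp.
  have := homotopic_rel_postcomp gc uv.
  by congr (homotopic_rel R _ _ _); apply: funext => t /=; rewrite fK.
(* A spheroid at f a maps the boundary of the cube into the range of f, where the deformation is
   stationary, so composing with it gives a homotopy relative to the boundary. *)
- move=> v [vc va]; exists (g \o v).
    by split=> [|x /va /= ->]; [exact: continuous_compose vc gc | rewrite fK].
  apply: homotopic_rel_sym.
  by apply: homotopic_rel_precomp vc _ fg => x /va ->; exists a.
Qed.

End Homotopies.

(** * Deformations of realizations *)

Section Pushforward.
Context (R : realType) (V W : finType) (iota : V -> W).
Hypothesis iota_inj : injective iota.

(** For injective [iota] this is extension by zero; as a sum it is visibly continuous and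
    mass-preserving. *)
Definition push (w : V -> R) (x : W) : R := \sum_(v | iota v == x) w v.

Lemma push_iota w v : push w (iota v) = w v.
Proof.
rewrite /push (eq_bigl (pred1 v)) ?big_pred1_eq// => u /=.
by rewrite (inj_eq iota_inj).
Qed.

Lemma push_notin w x : x \notin codom iota -> push w x = 0.
Proof.
move=> xn; rewrite /push big1// => v /eqP vx.
by move: xn; rewrite -vx codom_f.
Qed.

Lemma support_push w :
  [set x | push w x != 0]%SET = (iota @: [set v | w v != 0])%SET.
Proof.
apply/setP => x; rewrite inE; apply/idP/imsetP.
  have [/codomP[v ->]|xn] := boolP (x \in codom iota).
    by rewrite push_iota => wv; exists v; rewrite ?inE.
  by rewrite push_notin// eqxx.
by move=> [v]; rewrite inE => wv ->; rewrite push_iota.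
Qed.

Lemma sum_push w : \sum_x push w x = \sum_v w v.
Proof. by rewrite [RHS](partition_big iota predT). Qed.

Lemma push_continuous : continuous (push : {ptws V -> R} -> {ptws W -> R}).
Proof.
apply: continuous_ptws => x; apply: sumr_continuous => v _.
by apply: (@continuous_coord R _ V id v) => w; exact: cvg_id.
Qed.

Variables (K : simplicial_complex V) (L : simplicial_complex W).
Hypothesis KL : forall s, (s \in simplices K) = ((iota @: s)%SET \in simplices L).

Lemma push_realization (w : V -> R) : realization R K w -> realization R L (push w).
Proof.
move=> [w0 w1 wK]; split.
- by move=> x; apply: sumr_ge0 => v _.
- by rewrite sum_push.
- by rewrite support_push -KL.
Qed.

Definition realization_push (p : set_type (realization R K)) :
    set_type (realization R L) :=
  SigSub (mem_set (push_realization (set_mem (valP p)))).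

Lemma realization_push_continuous : continuous realization_push.
Proof.
apply: continuous_set_type.
exact: continuous_compose (@continuous_set_val _ _) push_continuous.
Qed.

(* q need not preserve total mass: it is normalised before use. *)
Definition deformation_flow (q : {ptws W -> R} * R -> {ptws W -> R}) : Prop :=
  [/\ continuous q,
      forall w t, realization R L w -> 0 <= t <= 1 ->
        (forall x, 0 <= q (w, t) x) /\
        [set x | q (w, t) x != 0]%SET \in simplices L,
      forall w, realization R L w -> forall x, q (w, 0) x = w x,
      forall w, realization R L w -> forall x, x \notin codom iota -> q (w, 1) x = 0 &
      forall w t, realization R K w -> 0 <= t <= 1 ->
        forall x, q (push w, t) x = push w x].

(** The support of q is a simplex, hence non-empty, so the total mass m is positive and q / m is a
    homotopy inside the realization of L. Where q fixes a point, m = 1, so normalising does not move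
    it. *)
Lemma deformation_flow_weak_equivalence q :
  deformation_flow q -> weak_homotopy_equivalence R realization_push.
Proof.
move=> [qc qL q0 q1 qK].
pose m (z : {ptws W -> R} * R) := \sum_x q z x.
have m_gt0 w t : realization R L w -> 0 <= t <= 1 -> 0 < m (w, t).
  move=> wL t01; have [ge0 supp] := qL w t wL t01.
  have /finset.set0Pn[x] := simplex_neq0 supp.
  rewrite inE => qx; rewrite /m (bigD1 x)//= ltr_wpDr//.
    by apply: sumr_ge0.
  by rewrite lt_neqAle eq_sym qx ge0.
pose n (z : {ptws W -> R} * R) : {ptws W -> R} := fun x => q z x / m z.
have nE0 z x : 0 < m z -> (n z x != 0) = (q z x != 0).
  by move=> mz; rewrite /n mulf_eq0 invr_eq0 (gt_eqF mz) orbF.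
have nL w t : realization R L w -> 0 <= t <= 1 -> realization R L (n (w, t)).
  move=> wL t01; have mz := m_gt0 w t wL t01; have [ge0 supp] := qL w t wL t01.
  split.
  - by move=> x; rewrite divr_ge0// ltW.
  - by rewrite /n -mulr_suml divff// gt_eqF.
  - rewrite (_ : [set x | _]%SET = [set x | q (w, t) x != 0]%SET)//.
    by apply/setP => x; rewrite !inE nE0.
have mw w t : realization R L w -> (forall x, q (w, t) x = w x) -> m (w, t) = 1.
  by move=> [_ w1 _] qw; rewrite /m -[RHS]w1; apply: eq_bigr => x _; rewrite qw.
pose H (z : set_type (realization R L) * R) : set_type (realization R L) :=
  SigSub (mem_set (nL _ _ (set_mem (valP z.1)) (clip_itv z.2))).
have HE z : set_val (H z) = n (set_val z.1, clip z.2) by [].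
have Hc : continuous H.
  apply: continuous_set_type.
  pose h (z : set_type (realization R L) * R) : {ptws W -> R} * R := (set_val z.1, clip z.2).
  have hc : continuous h.
    apply: continuous_pair.
      apply: continuous_compose; first exact: continuous_fst.
      exact: continuous_set_val.
    by apply: continuous_compose; [exact: continuous_snd | exact: clip_continuous].
  have qhc x : continuous (fun z => q (h z) x).
    by apply: (continuous_coord (f := q \o h)); apply: continuous_compose hc qc.
  apply: continuous_ptws => x; apply: divr_continuous => //.
    move=> z; rewrite gt_eqF// m_gt0//; last exact: clip_itv.
    exact: set_mem (valP z.1).
  by apply: sumr_continuous => y _; exact: qhc.
(* At time 1 all the weight lies on the image of [iota]; reading it there gives the retraction g. *)
have gK (p : set_type (realization R L)) :
    realization R K (fun v => n (set_val p, 1) (iota v)).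
  have pL := set_mem (valP p).
  have one01 : 0 <= (1 : R) <= 1 by rewrite lexx ler01.
  have [ge0 sum1 supp] := nL _ 1 pL one01.
  have n1 x : x \notin codom iota -> n (set_val p, 1) x = 0.
    by move=> xn; rewrite /n q1// mul0r.
  have nE : n (set_val p, 1) = push (fun v => n (set_val p, 1) (iota v)).
    apply: funext => x; have [/codomP[v ->]|xn] := boolP (x \in codom iota).
      by rewrite push_iota.
    by rewrite push_notin// n1.
  split=> //.
  - by rewrite -sum_push -nE.
  - by rewrite KL -support_push -nE.
pose g p : set_type (realization R K) := SigSub (mem_set (gK p)).
have zero01 : 0 <= (0 : R) <= 1 by rewrite lexx ler01.
have one01 : 0 <= (1 : R) <= 1 by rewrite lexx ler01.
have HK p t : H (realization_push p, t) = realization_push p.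
  have pK := set_mem (valP p).
  apply: val_inj; rewrite [LHS]HE; apply: funext => x.
  rewrite /n mw ?divr1; last by move=> y; apply: qK => //; exact: clip_itv.
    by apply: qK => //; exact: clip_itv.
  exact: push_realization.
have fgE p : realization_push (g p) = H (p, 1).
  have pL := set_mem (valP p).
  apply: val_inj; rewrite [RHS]HE /= clip_id//.
  apply: funext => x; have [/codomP[v ->]|xn] := boolP (x \in codom iota).
    by rewrite push_iota.
  by rewrite push_notin// /n q1// mul0r.
apply: (@retract_weak_homotopy_equivalence R _ _ _ g).
- exact: realization_push_continuous.
- apply: continuous_set_type; apply: continuous_ptws => v.
  have -> : (fun p => set_val (g p) v) = (fun p => set_val (H (p, 1)) (iota v)).
    by apply: funext => p; rewrite HE /= clip_id.
  apply: (@continuous_coord R _ W (fun p => set_val (H (p, 1)))).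
  apply: (@continuous_compose _ _ _ (fun p => H (p, 1))); last exact: continuous_set_val.
  apply: continuous_compose Hc.
  by apply: continuous_pair; [move=> p; exact: cvg_id | exact: cst_continuous].
- move=> p; apply: val_inj; apply: funext => v.
  have : n (push (set_val p), clip 1) (iota v) = push (set_val p) (iota v).
    exact: (congr1 (fun r : set_type (realization R L) => set_val r (iota v)) (HK p 1)).
  by rewrite clip_id// push_iota.
- apply/homotopic_relP; exists H; split=> //.
  + move=> p; have pL := set_mem (valP p).
    apply: val_inj; rewrite [LHS]HE /= clip_id//; apply: funext => x.
    by rewrite /n mw ?q0 ?divr1// => y; rewrite q0.
  + by move=> p /=; rewrite fgE.
  + by move=> _ t [p _ <-]; exact: HK.
Qed.

End Pushforward.

(** [push] does not depend on the index, so it commutes with inclusions on the nose; the flows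
    themselves need not be natural. *)
Lemma deformation_flow_objectwise (R : realType) (V W : finType) (iota : V -> W)
    (d : Order.disp_t) (I : preorderType d)
    (K : I -> simplicial_complex V) (L : I -> simplicial_complex W)
    (K_mono : forall x y, (x <= y)%O -> realization R (K x) `<=` realization R (K y))
    (L_mono : forall x y, (x <= y)%O -> realization R (L x) `<=` realization R (L y)) :
    injective iota ->
    (forall x s, (s \in simplices (K x)) = ((iota @: s)%SET \in simplices (L x))) ->
    (forall x, exists q, @deformation_flow R _ _ iota (K x) (L x) q) ->
  objectwise_weak_equivalence R (inclusion_functor K_mono) (inclusion_functor L_mono).
Proof.
move=> iota_inj KL flows.
pose eta x : inclusion_functor K_mono x -> inclusion_functor L_mono x :=
  realization_push iota_inj (KL x).
have eta_c x : continuous (eta x) by exact: realization_push_continuous.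
have eta_nat x y (xy : (x <= y)%O) p :
    eta y (Defs.fmap (inclusion_functor K_mono) xy p) =
    Defs.fmap (inclusion_functor L_mono) xy (eta x p).
  exact: val_inj.
exists (NatTrans eta_c eta_nat) => x /=.
have [q qflow] := flows x.
exact: deformation_flow_weak_equivalence qflow.
Qed.

(** * Galois connections *)

Definition chain (Y : finType) (le : rel Y) (F : {set Y}) : bool :=
  [forall y in F, forall z in F, le y z || le z y].

Lemma chainP (Y : finType) (le : rel Y) (F : {set Y}) :
  reflect {in F &, forall y z, le y z || le z y} (chain le F).
Proof.
apply: (iffP forall_inP) => [h y z yF zF|h y yF].
  exact: (forall_inP (h y yF)).
by apply/forall_inP => z zF; exact: h.
Qed.

Lemma chain_sub (Y : finType) (le : rel Y) (F G : {set Y}) :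
  F \subset G -> chain le G -> chain le F.
Proof.
move=> /fintype.subsetP FG /chainP Gch; apply/chainP => y z yF zF.
by apply: Gch; exact: FG.
Qed.

Section FlagComplex.
Context (Y : finType) (le : rel Y) (Q : {set Y}).

Definition flag_simplices : {set {set Y}} :=
  [set F | [&& F != finset.set0, F \subset Q & chain le F]]%SET.

Program Definition flag_complex : simplicial_complex Y :=
  @SimplicialComplex Y flag_simplices _ _.
Next Obligation. by move=> F; rewrite finset.inE => /andP[]. Qed.
Next Obligation.
move=> F G; rewrite !finset.inE => /and3P[_ FQ Fch] GF ->.
by rewrite (fintype.subset_trans GF FQ)/= (chain_sub GF).
Qed.

End FlagComplex.

(** * A complex containing both sides of a Galois connection *)

Section JoinComplex.
Context (V Y : finType) (T : simplicial_complex V) (Q : {set Y}) (le : rel Y).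
Context (B : Y -> {set V}).

Definition lpart (G : {set V + Y}) : {set V} := [set v | inl v \in G]%SET.
Definition rpart (G : {set V + Y}) : {set Y} := [set y | inr y \in G]%SET.

(** Joins of a face of T with a flag all of whose members have a B containing that face. Either part
    may be empty, which gives the copies of T and of the flag complex. *)
Definition join_simplices : {set {set V + Y}} :=
  [set G | [&& G != finset.set0,
               (lpart G == finset.set0) || (lpart G \in simplices T),
               rpart G \subset Q, chain le (rpart G) &
               [forall y in rpart G, lpart G \subset B y]]]%SET.

Lemma lpartS (G H : {set V + Y}) : G \subset H -> lpart G \subset lpart H.
Proof.
by move=> /fintype.subsetP GH; apply/fintype.subsetP => v; rewrite !finset.inE => /GH.
Qed.

Lemma rpartS (G H : {set V + Y}) : G \subset H -> rpart G \subset rpart H.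
Proof.
by move=> /fintype.subsetP GH; apply/fintype.subsetP => v; rewrite !finset.inE => /GH.
Qed.

Lemma join_simplicesP (G : {set V + Y}) : reflect
  [/\ G != finset.set0,
      forall s, lpart G = s -> s != finset.set0 -> s \in simplices T,
      rpart G \subset Q, chain le (rpart G) &
      forall v y, inl v \in G -> inr y \in G -> v \in B y]
  (G \in join_simplices).
Proof.
rewrite finset.inE; apply: (iffP and5P) => -[-> GT -> -> GB]; split=> //.
- by move=> s <-; case/orP: GT => [->|].
- move=> v y vG yG; have := forall_inP GB y; rewrite inE => /(_ yG).
  by move=> /fintype.subsetP; apply; rewrite inE.
- by have [//|n0] := eqVneq (lpart G) finset.set0; rewrite (GT _ erefl n0) orbT.
- apply/forall_inP => y; rewrite inE => yG.
  by apply/fintype.subsetP => v; rewrite inE => vG; exact: GB.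
Qed.

Program Definition join_complex : simplicial_complex (V + Y)%type :=
  @SimplicialComplex (V + Y)%type join_simplices _ _.
Next Obligation. by move=> G /join_simplicesP[]. Qed.
Next Obligation.
move=> G H /join_simplicesP[G0 GT GQ Gch GB] HG H0; apply/join_simplicesP.
have HGP := fintype.subsetP HG.
split=> //.
- move=> s Hs s0; have ls : s \subset lpart G by rewrite -Hs lpartS.
  apply: (simplex_face _ ls s0); apply: GT => //.
  by apply: contraNneq s0 => G0'; rewrite G0' finset.subset0 in ls.
- exact: fintype.subset_trans (rpartS HG) GQ.
- exact: chain_sub (rpartS HG) Gch.
- by move=> v y /HGP vG /HGP; exact: GB.
Qed.

Lemma join_complex_inl s :
  (s \in simplices T) = ((inl @: s)%SET \in simplices join_complex).
Proof.
have ls : lpart (inl @: s)%SET = s.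
  by apply/setP => v; rewrite inE mem_imset//; exact: inl_inj.
have rs : rpart (inl @: s)%SET = finset.set0.
  by apply/setP => y; rewrite !inE; apply/imsetP => -[].
apply/idP/join_simplicesP => [sT|[s0 sT _ _ _]].
  split.
  - apply/finset.set0Pn; have /finset.set0Pn[v vs] := simplex_neq0 sT.
    by exists (inl v); exact: imset_f.
  - by move=> _ <-; rewrite ls.
  - by rewrite rs finset.sub0set.
  - by rewrite rs; apply/chainP => y z; rewrite inE.
  - by move=> v y _ /imsetP[].
apply: sT ls _; apply: contraNneq s0 => ->; by rewrite finset.imset0.
Qed.

Lemma join_complex_inr (F : {set Y}) :
  (F \in simplices (flag_complex le Q)) =
  ((inr @: F)%SET \in simplices join_complex).
Proof.
have ls : rpart (inr @: F)%SET = F.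
  by apply/setP => v; rewrite inE mem_imset//; exact: inr_inj.
have rs : lpart (inr @: F)%SET = finset.set0.
  by apply/setP => y; rewrite !inE; apply/imsetP => -[].
rewrite inE; apply/and3P/join_simplicesP; rewrite ls rs => -[F0].
  move=> FQ Fch; split=> //.
  - have /finset.set0Pn[v vs] := F0.
    by apply/finset.set0Pn; exists (inr v); exact: imset_f.
  - by move=> _ <-; rewrite eqxx.
  - by move=> v y /imsetP[].
move=> _ -> -> _; split=> //.
by apply: contraNneq F0 => ->; rewrite finset.imset0.
Qed.

End JoinComplex.

Lemma join_complex_mono (V Y : finType) (T T' : simplicial_complex V)
    (Q Q' : {set Y}) (le : rel Y) (B B' : Y -> {set V}) :
  T \subset T' -> Q \subset Q' -> (forall y, y \in Q -> B y \subset B' y) ->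
  join_complex T Q le B \subset join_complex T' Q' le B'.
Proof.
move=> /fintype.subsetP TT' QQ' BB'; apply/fintype.subsetP => G.
move=> /join_simplicesP[G0 GT GQ Gch GB]; apply/join_simplicesP; split=> //.
- by move=> s Gs s0; apply/TT'/GT.
- exact: fintype.subset_trans QQ'.
- move=> v y vG yG; have yQ : y \in Q by apply: (fintype.subsetP GQ); rewrite inE.
  exact: (fintype.subsetP (BB' y yQ)) (GB _ _ vG yG).
Qed.

Lemma flag_complex_mono (Y : finType) (Q Q' : {set Y}) (le : rel Y) :
  Q \subset Q' -> flag_complex le Q \subset flag_complex le Q'.
Proof.
move=> QQ'; apply/fintype.subsetP => F; rewrite !inE => /and3P[-> FQ ->].
by rewrite (fintype.subset_trans FQ).
Qed.

(** * Retraction onto the complex T *)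

Section FlagFlow.
Context (R : realType) (V Y : finType) (T : simplicial_complex V) (Q : {set Y}).
Context (le : rel Y) (B : Y -> {set V}) (c : {set V} -> Y).

(* A Galois connection between the face poset of T and Q: c s <= y if and    *)
(* only if s is contained in B y.                                            *)
Definition galois : Prop :=
  [/\ reflexive le, transitive le, forall y, y \in Q -> B y \in simplices T,
      forall y z, le y z -> B y \subset B z &
      forall s, s \in simplices T ->
        [/\ c s \in Q, s \subset B (c s) &
            forall y, y \in Q -> s \subset B y -> le (c s) y]].

Hypothesis gal : galois.
Local Notation E := (join_complex T Q le B).
Local Notation space := {ptws (V + Y) -> R}.

(** Give y the interval of length [z.1 (inr y)] ending at the cumulative weight up to y; this is the
    length of its part above [z.2]. No sorting of the flag is involved, so continuity is
    immediate. *)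
Definition head_weight (z : space * R) (y : Y) : R :=
  Num.max 0 (Num.min (z.1 (inr y)) (\sum_(y' | le y' y) z.1 (inr y') - z.2)).

(* At time t, the lowest part of the flag, of total weight t, has been moved *)
(* to T.                                                                     *)
Definition flag_flow (z : space * R) : space := fun x =>
  match x with
  | inl v => z.1 (inl v) + \sum_(y | [pick u in B y] == Some v)
                             (z.1 (inr y) - head_weight z y)
  | inr y => head_weight z y
  end.

Lemma weight_continuous x : continuous (fun z : space * R => z.1 x).
Proof. by apply: (@continuous_coord R _ _ fst x); exact: continuous_fst. Qed.

Lemma head_weight_continuous y : continuous (head_weight^~ y).
Proof.
apply: maxr_continuous; first exact: cst_continuous.
apply: minr_continuous; first exact: weight_continuous.
apply: subr_continuous; last exact: continuous_snd.
by apply: sumr_continuous => y' _; exact: weight_continuous.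
Qed.

Lemma flag_flow_continuous : continuous flag_flow.
Proof.
apply: continuous_ptws => -[v|y]; last exact: head_weight_continuous.
apply: addr_continuous; first exact: weight_continuous.
apply: sumr_continuous => y _; apply: subr_continuous; first exact: weight_continuous.
exact: head_weight_continuous.
Qed.

Lemma head_weight_ge0 z y : 0 <= head_weight z y.
Proof. by rewrite le_max lexx. Qed.

Lemma head_weight_le (z : space * R) y : 0 <= z.1 (inr y) -> head_weight z y <= z.1 (inr y).
Proof. by move=> w0; rewrite ge_max w0 ge_min lexx. Qed.

Lemma head_weight_neq0 z y : (head_weight z y != 0) =
  (0 < z.1 (inr y)) && (z.2 < \sum_(y' | le y' y) z.1 (inr y')).
Proof.
rewrite -[_ < \sum_(_ | _) _]subr_gt0 -lt_min /head_weight.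
by case: (ltP 0 (Num.min _ _)) => [/gt_eqF ->|]; rewrite ?eqxx.
Qed.

Lemma tail_weight_gt0 (z : space * R) y : 0 <= z.1 (inr y) ->
  z.1 (inr y) - head_weight z y != 0 ->
  0 < z.1 (inr y) /\ \sum_(y' | le y' y) z.1 (inr y') - z.1 (inr y) < z.2.
Proof.
move=> w0; rewrite subr_eq0 => wh.
have {wh} : head_weight z y < z.1 (inr y) by rewrite lt_neqAle eq_sym wh head_weight_le.
by rewrite gt_max gt_min ltxx /= => /andP[-> h]; split=> //; lra.
Qed.

(** Weight leaves the flag from the bottom. If y' has lost weight and y keeps some, then y' lies
    below y, so the vertex of B y' that received the weight also belongs to B y: the support remains
    a simplex. *)
Lemma flag_flow_deformation : deformation_flow (@inl V Y) T E flag_flow.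
Proof.
case: gal => le_refl le_trans BT B_mono _.
split.
- exact: flag_flow_continuous.
- move=> w t [w0 w1 wE] /andP[t0 t1].
  have [S0 ST SQ /chainP Sch SB] := join_simplicesP _ _ _ _ _ wE.
  set S := [set v | w v != 0]%SET in wE S0 ST SQ Sch SB.
  have tail_ge0 y : 0 <= w (inr y) - head_weight (w, t) y.
    by rewrite subr_ge0 head_weight_le.
  have ge0 x : 0 <= flag_flow (w, t) x.
    case: x => [v|y] /=; last exact: head_weight_ge0.
    by rewrite addr_ge0// sumr_ge0.
  split=> //.
  have inl_supp v : flag_flow (w, t) (inl v) != 0 -> inl v \in S \/
      exists y, [/\ inr y \in S, v \in B y &
        \sum_(y' | le y' y) w (inr y') - w (inr y) < t].
    rewrite /= inE; have [wv|] := eqVneq (w (inl v)) 0; last by left.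
    rewrite wv add0r => sn0; right.
    have /existsP[y] : [exists y, ([pick u in B y] == Some v) &&
        (w (inr y) - head_weight (w, t) y != 0)].
      apply: contraNT sn0; rewrite negb_exists => /forallP n.
      rewrite big1// => y yv; have := n y; rewrite yv /= negbK; exact/eqP.
    case/andP => /eqP yv /(@tail_weight_gt0 (w, t) y (w0 _))[/= wy yt]; exists y; split=> //.
      by rewrite inE gt_eqF.
    by move: yv; case: pickP => // u uB [<-].
  have inr_supp y : flag_flow (w, t) (inr y) != 0 ->
      inr y \in S /\ t < \sum_(y' | le y' y) w (inr y').
    by rewrite /= head_weight_neq0 /= inE => /andP[wy ty]; rewrite gt_eqF.
  apply/join_simplicesP; split.
  + have /finset.set0Pn[[v|y]] := S0; rewrite inE => wx; apply/finset.set0Pn.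
      exists (inl v); rewrite inE /= gt_eqF// ltr_pwDl ?sumr_ge0//.
      by rewrite lt_neqAle eq_sym wx w0.
    (* If y is exhausted, its weight sits on a vertex of B y, which is non-empty as a simplex of
       T. *)
    have [hy|hy] := eqVneq (head_weight (w, t) y) 0; last by exists (inr y); rewrite inE.
    have yQ : y \in Q by apply: (fintype.subsetP SQ); rewrite !inE.
    have /finset.set0Pn[u uB] := simplex_neq0 (BT y yQ).
    case yv: [pick u in B y] => [v|]; last first.
      by move: yv; case: pickP => // /(_ u); rewrite uB.
    exists (inl v); rewrite inE /= gt_eqF// ltr_wpDl//.
    rewrite (bigD1 y) ?yv//= hy subr0 ltr_pwDl ?sumr_ge0//.
    by rewrite lt_neqAle eq_sym wx w0.
  + move=> s sE s0.
    have [F0|/finset.set0Pn[y0 y0F]] := eqVneq (rpart S) finset.set0.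
      have ls : s \subset lpart S.
        apply/fintype.subsetP => v; rewrite -sE !inE => /inl_supp[|[y [yS _ _]]].
          by rewrite inE.
        have : y \in rpart S by rewrite finset.inE.
        by rewrite F0 finset.inE.
      apply: (simplex_face _ ls s0); apply: ST => //.
      by apply: contraNneq s0 => G0'; rewrite G0' finset.subset0 in ls.
    (* On a chain the sets B are nested, so the one of greatest cardinality contains the others; it
       is the simplex of T that bounds the new support. *)
    have [y yF ymax] := arg_maxnP (fun y => #|B y|) y0F.
    have yB y' : y' \in rpart S -> B y' \subset B y.
      move=> y'F; have /orP[/B_mono//|/B_mono yy'] := Sch _ _ y'F yF.
      have /eqP <- // : B y == B y' by rewrite finset.eqEcard yy'; exact: ymax.
    have yQ := fintype.subsetP SQ y yF.
    apply: (simplex_face (BT y yQ) _ s0).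
    apply/fintype.subsetP => v; rewrite -sE !inE => /inl_supp[vS|[y' [y'S vy' _]]].
      by apply: SB vS _; have : y \in rpart S := yF; rewrite finset.inE.
    by apply: (fintype.subsetP (yB y' _)) => //; rewrite inE.
  + by apply/fintype.subsetP => y; rewrite !inE => /inr_supp[yS _]; apply: (fintype.subsetP SQ); rewrite inE.
  + apply/chainP => y z; rewrite !inE => /inr_supp[yS _] /inr_supp[zS _].
    by apply: Sch; rewrite inE.
  + move=> v y; rewrite !inE => /inl_supp vS /inr_supp[yS ty].
    case: vS => [vS|[y' [y'S vy' y't]]]; first exact: SB.
    apply/(fintype.subsetP (B_mono y' y _)) => //.
    apply: contraT => y'y; have yy' : le y y'.
      by have := Sch y y'; rewrite (negbTE y'y) orbF; apply; rewrite finset.inE.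
    (* If y' is not below y, the cumulative weight up to y omits that of y', hence is less than t,
       and y would be exhausted. *)
    have : \sum_(z | le z y) w (inr z) <= \sum_(z | le z y') w (inr z) - w (inr y').
      rewrite [X in _ <= X - _](bigD1 y')//= [leRHS]addrAC subrr add0r.
      rewrite [leLHS]big_mkcond [leRHS]big_mkcond; apply: ler_sum => z _.
      case: ifPn => zy; last by case: ifP.
      rewrite (le_trans _ _ _ zy yy') ifT//=.
      by apply: contraNneq y'y => <-.
    lra.
- move=> w [w0 w1 wE] x; have hw y : head_weight (w, 0) y = w (inr y).
    rewrite /head_weight /= subr0 min_l ?max_r//.
    by rewrite (bigD1 y)//= lerDl sumr_ge0.
  case: x => [v|y] /=; last exact: hw.
  by rewrite big1 ?addr0// => y _; rewrite hw subrr.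
- move=> w [w0 w1 wE] [v|y]; first by rewrite codom_f.
  (* Cumulative weights are at most the total mass 1. *)
  move=> _ /=; rewrite /head_weight /= max_l// ge_min; apply/orP; right.
  rewrite subr_le0 -w1 big_sumType /= -[leLHS]add0r lerD ?sumr_ge0//.
  by rewrite big_mkcond ler_sum// => y' _; case: ifP.
- move=> w t [w0 w1 wT] /andP[t0 t1].
  have pr y : push inl w (inr y : V + Y) = 0.
    by rewrite push_notin//; apply/codomP => -[].
  have hw y : head_weight (push inl w, t) y = 0.
    by apply/eqP; apply: contraT; rewrite head_weight_neq0 /= pr ltxx.
  by move=> [v|y] /=; rewrite ?hw ?pr// big1 ?addr0// => y _; rewrite hw pr subrr.
Qed.

End FlagFlow.

(** * Retraction onto the order complex *)

Section LayerFlow.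
Context (R : realType) (V Y : finType) (T : simplicial_complex V) (Q : {set Y}).
Context (le : rel Y) (B : Y -> {set V}) (c : {set V} -> Y).
Hypothesis gal : galois T Q le B c.
Local Notation E := (join_complex T Q le B).
Local Notation space := {ptws (V + Y) -> R}.

(* Vanishes unless s is an upper level set of the coordinates of z.1 in V,   *)
(* at a level smaller than z.2.                                              *)
Definition layer (s : {set V}) (z : space * R) : R :=
  z.2 * \prod_(v in s) z.1 (inl v) *
  \prod_(v in s) \prod_(u | u \notin s) Num.max 0 (z.1 (inl v) - z.1 (inl u)) *
  \prod_(u | u \notin s) Num.max 0 (z.2 - z.1 (inl u)).

Lemma layer_ge0 s z : 0 <= z.2 -> (forall x, 0 <= z.1 x) -> 0 <= layer s z.
Proof.
move=> t0 w0; rewrite !mulr_ge0// prodr_ge0// => v _; last by rewrite le_max lexx.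
by rewrite prodr_ge0// => u _; rewrite le_max lexx.
Qed.

Lemma max0_neq0 (x : R) : (Num.max 0 x != 0) = (0 < x).
Proof. by case: (ltP 0 x) => [/gt_eqF ->|]; rewrite ?eqxx. Qed.

(** Only the vanishing of [layer] matters, not its value: the flow is normalised afterwards. Hence a
    product of truncated differences suffices. *)
Lemma layer_neq0 s z : layer s z != 0 <->
  [/\ z.2 != 0, forall v, v \in s -> z.1 (inl v) != 0,
      forall v u, v \in s -> u \notin s -> z.1 (inl u) < z.1 (inl v) &
      forall u, u \notin s -> z.1 (inl u) < z.2].
Proof.
rewrite /layer !mulf_eq0 !negb_or -!andbA; split.
  move=> /and4P[-> /prodf_neq0 n1 /prodf_neq0 n2 /prodf_neq0 n3]; split=> //.
  - move=> v u vs us; have /prodf_neq0 := n2 v vs.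
    by move=> /(_ u us); rewrite max0_neq0 subr_gt0.
  - by move=> u us; have := n3 u us; rewrite max0_neq0 subr_gt0.
move=> [-> n1 n2 n3]; apply/and4P; split=> //.
- by apply/prodf_neq0.
- apply/prodf_neq0 => v vs; apply/prodf_neq0 => u us.
  by rewrite max0_neq0 subr_gt0; exact: n2.
- by apply/prodf_neq0 => u us; rewrite max0_neq0 subr_gt0; exact: n3.
Qed.

(* At time t, the part of the coordinates in V below height t has been moved *)
(* to the chain of simplices c s, for s an upper level set.                  *)
Definition layer_flow (z : space * R) : space := fun x =>
  match x with
  | inl v => Num.max 0 (z.1 (inl v) - z.2)
  | inr y => z.1 (inr y) + \sum_(s in simplices T | c s == y) layer s z
  end.

Lemma layer_continuous s : continuous (layer s).
Proof.
have zc (x : V + Y) : continuous (fun z : space * R => z.1 x).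
  exact: (@weight_continuous R V Y x).
have c0 : continuous (fun _ : space * R => 0 : R) by exact: cst_continuous.
apply: mulr_continuous; last first.
  apply: prodr_continuous => u _; apply: maxr_continuous => //.
  by apply: subr_continuous => //; exact: continuous_snd.
apply: mulr_continuous; last first.
  apply: prodr_continuous => v _; apply: prodr_continuous => u _.
  by apply: maxr_continuous => //; apply: subr_continuous.
apply: mulr_continuous; first exact: continuous_snd.
by apply: prodr_continuous.
Qed.

Lemma layer_flow_continuous : continuous layer_flow.
Proof.
have zc (x : V + Y) : continuous (fun z : space * R => z.1 x).
  exact: (@weight_continuous R V Y x).
apply: continuous_ptws => -[v|y].
  apply: maxr_continuous; first exact: cst_continuous.
  by apply: subr_continuous => //; exact: continuous_snd.
apply: addr_continuous => //.
by apply: sumr_continuous => s _; exact: layer_continuous.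
Qed.

(** Upper level sets are nested and c is monotone, so the new members form a chain; each such s is
    contained in B y for every old y, so c s lies below y. A vertex still above height t belongs to
    every active s, hence to B (c s). *)
Lemma layer_flow_deformation :
  deformation_flow (@inr V Y) (flag_complex le Q) E layer_flow.
Proof.
case: gal => _ _ _ _ cT.
split.
- exact: layer_flow_continuous.
- move=> w t [w0 w1 wE] /andP[t0 t1].
  have [S0 ST SQ /chainP Sch SB] := join_simplicesP _ _ _ _ _ wE.
  set S := [set v | w v != 0]%SET in wE S0 ST SQ Sch SB.
  have l0 s : 0 <= layer s (w, t) by exact: layer_ge0.
  have ge0 x : 0 <= layer_flow (w, t) x.
    case: x => [v|y] /=; first by rewrite le_max lexx.
    by rewrite addr_ge0// sumr_ge0.
  split=> //.
  have inl_supp v : (layer_flow (w, t) (inl v) != 0) = (t < w (inl v)).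
    by rewrite /= max0_neq0 subr_gt0.
  have inS v : t < w (inl v) -> inl v \in S.
    by move=> tv; rewrite inE gt_eqF// (le_lt_trans t0).
  have inr_supp y : layer_flow (w, t) (inr y) != 0 -> inr y \in S \/
      exists s, [/\ s \in simplices T, c s = y & layer s (w, t) != 0].
    rewrite /= inE; have [wy|] := eqVneq (w (inr y)) 0; last by left.
    rewrite wy add0r => sn0; right.
    have /existsP[s /andP[/andP[sT /eqP cs] ls]] :
        [exists s, (s \in simplices T) && (c s == y) && (layer s (w, t) != 0)].
      apply: contraNT sn0; rewrite negb_exists => /forallP n.
      rewrite big1// => s sT; have := n s; rewrite sT /= negbK; exact/eqP.
    by exists s.
  have layer_sub s : layer s (w, t) != 0 -> s \subset lpart S.
    move=> /layer_neq0[_ ws _ _]; apply/fintype.subsetP => v /ws.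
    by rewrite !inE.
  have layer_chain s s' : layer s (w, t) != 0 -> layer s' (w, t) != 0 ->
      (s \subset s') || (s' \subset s).
    move=> /layer_neq0[_ _ gs _] /layer_neq0[_ _ gs' _].
    apply: contraT; rewrite negb_or => /andP[/fintype.subsetPn[v vs vs']].
    move=> /fintype.subsetPn[u us' us].
    by have := lt_trans (gs v u vs us) (gs' u v us' vs'); rewrite ltxx.
  have inr_in (y : Y) : inr y \in S -> y \in Q.
    by move=> yS; apply: (fintype.subsetP SQ); rewrite finset.inE.
  have S_B (s : {set V}) y : s \subset lpart S -> inr y \in S -> s \subset B y.
    move=> sS yS; apply/fintype.subsetP => v vs.
    by have := fintype.subsetP sS v vs; rewrite finset.inE => vS; exact: SB.
  apply/join_simplicesP; split.
  + have add_supp x : w x != 0 -> forall r, 0 <= r -> w x + r != 0.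
      by move=> wx r r0; rewrite gt_eqF// ltr_pwDl// lt_neqAle eq_sym wx w0.
    have sum_supp s : s \in simplices T -> layer s (w, t) != 0 ->
        layer_flow (w, t) (inr (c s)) != 0.
      move=> sT ls; rewrite /= (bigD1 s) ?sT ?eqxx//= addrCA gt_eqF//.
      rewrite ltr_pwDl//; first by rewrite lt_neqAle eq_sym ls l0.
      by rewrite addr_ge0// sumr_ge0.
    have /finset.set0Pn[[v0|y]] := S0; rewrite inE => wx; last first.
      by apply/finset.set0Pn; exists (inr y); rewrite inE /= add_supp// sumr_ge0.
    (* Either the largest coordinate is still above t, or the set s of vertices attaining it is an
       active layer. *)
    have [v _ vmax] := @Order.TotalTheory.arg_maxP _ _ _ v0 predT (fun v => w (inl v)) isT.
    have wv : 0 < w (inl v).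
      by apply: lt_le_trans (vmax v0 isT); rewrite lt_neqAle eq_sym wx w0.
    have [tv|vt] := ltP t (w (inl v)).
      by apply/finset.set0Pn; exists (inl v); rewrite inE inl_supp.
    pose s := [set u | w (inl u) == w (inl v)]%SET.
    have vs : v \in s by rewrite inE.
    have ltv u : u \notin s -> w (inl u) < w (inl v).
      by rewrite inE => uv; rewrite lt_neqAle uv; exact: vmax.
    have ls : layer s (w, t) != 0.
      apply/layer_neq0; split=> /=.
      - by rewrite gt_eqF// (lt_le_trans wv).
      - by move=> u; rewrite inE => /eqP ->; rewrite gt_eqF.
      - by move=> u u'; rewrite inE => /eqP -> /ltv.
      - by move=> u /ltv uv; apply: lt_le_trans uv vt.
    have sT : s \in simplices T.
      have s0 : s != finset.set0 by apply/finset.set0Pn; exists v.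
      apply: (simplex_face _ (layer_sub s ls) s0); apply: ST => //.
      by apply/finset.set0Pn; exists v; apply: (fintype.subsetP (layer_sub s ls)).
    by apply/finset.set0Pn; exists (inr (c s)); rewrite inE; exact: sum_supp.
  + move=> s sE s0.
    have ls : s \subset lpart S.
      by apply/fintype.subsetP => v; rewrite -sE !finset.inE inl_supp => /inS; rewrite finset.inE.
    apply: (simplex_face _ ls s0); apply: ST => //.
    by apply: contraNneq s0 => G0'; rewrite G0' finset.subset0 in ls.
  + apply/fintype.subsetP => y; rewrite !finset.inE => /inr_supp[/inr_in//|].
    by move=> [s [/cT[csQ _ _] <- _]].
  + have mixed s y : s \in simplices T -> layer s (w, t) != 0 -> inr y \in S -> le (c s) y.
      move=> /cT[_ _ lec] ls yS; apply: lec; first exact: inr_in.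
      by apply: S_B yS; exact: layer_sub.
    have mono s s' : s \in simplices T -> s' \in simplices T -> s \subset s' -> le (c s) (c s').
      move=> /cT[_ _ lec] /cT[cQ sB _] ss'; apply: lec => //.
      exact: fintype.subset_trans ss' sB.
    apply/chainP => y z; rewrite !finset.inE.
    move=> /inr_supp[yS|[s [sT <- ls]]] /inr_supp[zS|[s' [sT' <- ls']]].
    * by apply: Sch; rewrite finset.inE.
    * by rewrite mixed ?orbT.
    * by rewrite mixed.
    * by have /orP[ss'|ss'] := layer_chain s s' ls ls'; rewrite (mono _ _ _ _ ss') ?orbT.
  + move=> v y; rewrite !finset.inE inl_supp => tv /inr_supp[yS|[s [sT <- ls]]].
      by apply: SB yS; exact: inS.
    have [_ sB _] := cT s sT; apply: (fintype.subsetP sB).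
    have /layer_neq0[_ _ _ lt_t] := ls; apply: contraT => /lt_t /= vt.
    by have := lt_trans tv vt; rewrite ltxx.
- move=> w [w0 w1 wE] [v|y] /=; first by rewrite subr0 max_r.
  by rewrite big1 ?addr0// => s _; rewrite /layer /= !mul0r.
- move=> w [w0 w1 wE] [v|y]; last by rewrite codom_f.
  (* Each coordinate is at most the total mass 1. *)
  move=> _ /=; rewrite max_l// subr_le0 -w1 (bigD1 (inl v))//= lerDl.
  exact: sumr_ge0.
- move=> w t [w0 w1 wT] /andP[t0 t1].
  have pl v : push inr w (inl v : V + Y) = 0.
    by rewrite push_notin//; apply/codomP => -[].
  move=> [v|y] /=; first by rewrite pl sub0r max_l// oppr_le0.
  rewrite big1 ?addr0// => s /andP[sT _].
  have /finset.set0Pn[v vs] := simplex_neq0 sT.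
  by rewrite /layer /= (bigD1 v)//= pl !(mul0r, mulr0).
Qed.

End LayerFlow.

(** * Galois connections over a filtration *)

Section GaloisEquivalence.
Context (R : realType) (V Y : finType) (d : Order.disp_t) (I : preorderType d).
Context (T : I -> simplicial_complex V) (Q : I -> {set Y}) (le : rel Y).
Context (B : I -> Y -> {set V}) (c : I -> {set V} -> Y).
Hypothesis T_sub : forall i j, (i <= j)%O -> T i \subset T j.
Hypothesis Q_sub : forall i j, (i <= j)%O -> Q i \subset Q j.
Hypothesis B_sub : forall i j y, (i <= j)%O -> y \in Q i -> B i y \subset B j y.
Hypothesis gal : forall i, galois (T i) (Q i) le (B i) (c i).

Lemma galois_join_mono i j : (i <= j)%O ->
  realization R (join_complex (T i) (Q i) le (B i)) `<=`
  realization R (join_complex (T j) (Q j) le (B j)).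
Proof.
move=> ij; apply/realization_sub/join_complex_mono; [exact: T_sub|exact: Q_sub|].
by move=> y; exact: B_sub.
Qed.

Lemma galois_weak_equivalence
    (T_mono : forall i j, (i <= j)%O -> realization R (T i) `<=` realization R (T j)) :
  objectwise_weak_equivalence R (inclusion_functor T_mono)
    (inclusion_functor galois_join_mono).
Proof.
apply: (@deformation_flow_objectwise R _ _ inl) => [|i s|i].
- exact: inl_inj.
- exact: join_complex_inl.
- by exists (@flag_flow R _ _ le (B i)); exact: flag_flow_deformation (gal i).
Qed.

(** Only the sets of simplices have to agree, so F can be [subdivision_complex], a different
    record. *)
Lemma galois_flag_weak_equivalence (F : I -> simplicial_complex Y)
    (FQ : forall i, simplices (F i) = flag_complex le (Q i))
    (F_mono : forall i j, (i <= j)%O -> realization R (F i) `<=` realization R (F j)) :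
  objectwise_weak_equivalence R (inclusion_functor F_mono)
    (inclusion_functor galois_join_mono).
Proof.
apply: (@deformation_flow_objectwise R _ _ inr) => [|i s|i].
- exact: inr_inj.
- by rewrite FQ; exact: join_complex_inr.
- exists (@layer_flow R _ _ (T i) (c i)).
  have := layer_flow_deformation R (gal i).
  have -> // : flag_complex le (Q i) = F i.
  case: (F i) (FQ i) => S S0 Sf /= SE; move: S0 Sf; rewrite SE => S0 Sf.
  by rewrite /flag_complex; congr SimplicialComplex; exact: Prop_irrelevance.
Qed.

End GaloisEquivalence.

(** * Witness complexes *)

(** [interleaved] asks for equality of functors; here the objects and maps agree and the remaining
    fields are proofs. *)
Lemma restrict_inclusion_functor (E : topologicalType) (d d' : Order.disp_t)
    (I : preorderType d) (J : preorderType d') (h : I -> J)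
    (h_homo : {homo h : x y / (x <= y)%O}) (A : J -> set E)
    (A_mono : forall x y, (x <= y)%O -> A x `<=` A y)
    (Ah_mono : forall x y, (x <= y)%O -> A (h x) `<=` A (h y)) :
  Defs.restrict h_homo (inclusion_functor A_mono) = inclusion_functor Ah_mono.
Proof.
have Functor_irr ob fm a1 a2 a3 b1 b2 b3 :
    @Functor d I ob fm a1 a2 a3 = @Functor d I ob fm b1 b2 b3.
  by rewrite (Prop_irrelevance a1 b1) (Prop_irrelevance a2 b2) (Prop_irrelevance a3 b3).
rewrite (Prop_irrelevance Ah_mono (fun x y xy => A_mono _ _ (h_homo x y xy))).
exact: Functor_irr.
Qed.

(** This trivial connection makes a complex equivalent to its barycentric subdivision. *)
Lemma galois_faces (V : finType) (T : simplicial_complex V) :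
  galois T (simplices T) (fun s t : {set V} => s \subset t) id id.
Proof.
by split=> // s t u; exact: fintype.subset_trans.
Qed.

Lemma chain_rev (Y : finType) (le : rel Y) (F : {set Y}) :
  chain le F = chain (fun y z => le z y) F.
Proof. by apply/chainP/chainP => Fch y z yF zF; rewrite orbC; exact: Fch. Qed.

(** * Simplices of large dimension *)

Section SubdivisionFaces.
Context (R : realType) (V : finType).

Definition large_simplices (T : simplicial_complex V) (k : R) : {set {set V}} :=
  [set s in simplices T | k - 1 <= (Defs.dim s)%:R]%SET.

Lemma dimS (s t : {set V}) : s \subset t -> (Defs.dim s <= Defs.dim t)%N.
Proof. by move=> st; rewrite /Defs.dim -!subn1 leq_sub2r// subset_leq_card. Qed.

(** The members of a flag contain its minimum, so a lower bound on the dimension of the minimum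
    holds for all of them. *)
Lemma subdivision_flag (T : simplicial_complex V) (k : R) :
  simplices (subdivision_complex T k) =
  flag_complex (fun s t : {set V} => t \subset s) (large_simplices T k).
Proof.
apply/setP => F; rewrite !finset.inE; apply/and3P/and3P => -[].
  move=> FT Fch /exists_inP[s sF /andP[/forall_inP smin ks]]; split.
  - by apply/finset.set0Pn; exists s.
  - apply/fintype.subsetP => t tF; rewrite inE (fintype.subsetP FT)//=.
    by apply: le_trans ks _; rewrite ler_nat; apply: dimS; exact: smin.
  - by rewrite -chain_rev.
move=> /finset.set0Pn[s0 s0F] FT; rewrite -chain_rev => Fch; split=> //.
  by apply: fintype.subset_trans FT _; apply/fintype.subsetP => s; rewrite inE => /andP[].
have [s sF smin] := arg_minnP (fun s : {set V} => #|s|) s0F.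
apply/exists_inP; exists s => //; apply/andP; split; last first.
  by have := fintype.subsetP FT s sF; rewrite inE => /andP[].
apply/forall_inP => t tF; have /orP[//|ts] := chainP _ _ Fch _ _ sF tF.
by have /eqP -> // : t == s; rewrite finset.eqEcard ts; exact: smin.
Qed.

(** A vertex of s is adjacent to the dim s others. *)
Lemma large_degree_simplices (T : simplicial_complex V) (k : R) :
  large_simplices T k \subset degree_complex T k.
Proof.
apply/fintype.subsetP => s; rewrite !inE => /andP[sT ks]; rewrite sT/=.
apply/forall_inP => v vs; apply: le_trans ks _; rewrite ler_nat /Defs.dim.
rewrite (cardsD1 v s) vs /=; apply/subset_leq_card/fintype.subsetP => u.
rewrite !inE => /andP[uv us]; rewrite uv /=; apply: simplex_face sT _ _.
  by apply/fintype.subsetP => x; rewrite !inE => /orP[] /eqP ->.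
by apply/finset.set0Pn; exists u; rewrite !inE eqxx.
Qed.

Lemma large_simplices_mono (T T' : simplicial_complex V) (k k' : R) :
  T \subset T' -> k' <= k -> large_simplices T k \subset large_simplices T' k'.
Proof.
move=> /fintype.subsetP TT' kk'; apply/fintype.subsetP => s; rewrite !inE.
by move=> /andP[/TT' -> ks]/=; apply: le_trans ks; rewrite lerB.
Qed.

End SubdivisionFaces.

(** * Points represented by subsets of X, and Dowker duality *)

Section Witness.
Context (R : realType) (Z : metricType R) (X : {fset Z}).
Implicit Types (p s : {set X}) (x y : X) (tau : {set {set X}}) (r : R).

(* A non-empty subset p of X stands for a point of Z at which the largest    *)
(* distance to p comes arbitrarily close to its infimum; such a point need   *)
(* not exist, but near p x r says that it belongs to B(x, r).                *)
Definition near p x r : bool :=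
  `[< exists t, p \in simplices (cech X t) /\
      \bigcap_(y in [set` p]) ball (val y) t `<=` ball (val x) r >].

Lemma near_vertex p x r : p \in simplices (cech X r) -> x \in p -> near p x r.
Proof. by move=> pr xp; apply/asboolP; exists r; split=> // z; exact. Qed.

Lemma near_mono p x r r' : r <= r' -> near p x r -> near p x r'.
Proof.
move=> rr' /asboolP[t [pt px]]; apply/asboolP; exists t; split=> // z /px.
exact: le_ball.
Qed.

(** For the least of the finitely many radii t attached to the x in s, a common point of the balls
    about p lies in every B(x, r). *)
Lemma near_cech p s r : s != finset.set0 -> (forall x, x \in s -> near p x r) ->
  s \in simplices (cech X r).
Proof.
move=> s0 ps; have /choice[f fP] : forall x, exists t, x \in s ->
    p \in simplices (cech X t) /\
    \bigcap_(y in [set` p]) ball (val y) t `<=` ball (val x) r.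
  by move=> x; have [/ps/asboolP[t ?]|] := boolP (x \in s); [exists t | exists 0].
have /finset.set0Pn[x0 x0s] := s0.
have [x xs xmin] := @Order.TotalTheory.arg_minP _ _ _ x0 (mem s) f x0s.
have [] := fP x xs; rewrite inE => /andP[_ /asboolP[z pz]] _.
rewrite inE s0; apply/asboolP; exists z => y ys.
have [_] := fP y ys; apply=> u up.
by apply: le_ball (pz u up); exact: xmin.
Qed.

(** With w common to B(x, r) and B(y, r), go from y to w, to x, to z: three steps shorter than r. *)
Lemma near_triple p x y r : near p x r -> [set y; x]%SET \in simplices (cech X r) ->
  near p y (3 * r).
Proof.
move=> /asboolP[t [pt px]]; rewrite inE => /andP[_ /asboolP[w wxy]].
apply/asboolP; exists t; split=> // z /px xz.
have -> : 3 * r = r + r + r by lra.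
apply: ball_triangle xz; apply: (ball_triangle (y := w)).
  by apply: wxy => /=; rewrite !inE eqxx.
by apply: ball_sym; apply: wxy => /=; rewrite !inE eqxx orbT.
Qed.

Definition common r tau : {set X} := [set x | [forall p in tau, near p x r]]%SET.

Definition points r s : {set {set X}} := [set p | [forall x in s, near p x r]]%SET.

Lemma sub_commonP r tau s :
  reflect {in s & tau, forall x p, near p x r} (s \subset common r tau).
Proof.
apply: (iffP fintype.subsetP) => [h x p xs pt|h x xs].
  by have := h x xs; rewrite inE => /forall_inP; apply.
by rewrite inE; apply/forall_inP => p pt; exact: h.
Qed.

Lemma sub_pointsP r tau s :
  reflect {in s & tau, forall x p, near p x r} (tau \subset points r s).
Proof.
apply: (iffP fintype.subsetP) => [h x p xs pt|h p pt].
  by have := h p pt; rewrite inE => /forall_inP; apply.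
by rewrite inE; apply/forall_inP => x xs; exact: h.
Qed.

Lemma common_cech r tau : tau != finset.set0 -> common r tau != finset.set0 ->
  common r tau \in simplices (cech X r).
Proof.
move=> /finset.set0Pn[p pt] c0; apply: (near_cech (p := p)) => // x.
by rewrite inE => /forall_inP; apply.
Qed.

Definition witness_simplices (Q : {set {set X}}) r : {set {set {set X}}} :=
  [set tau | (tau != finset.set0) && [exists s in Q, s \subset common r tau]]%SET.

Program Definition witness_complex Q r : simplicial_complex {set X} :=
  @SimplicialComplex {set X} (witness_simplices Q r) _ _.
Next Obligation. by move=> Q r tau; rewrite inE => /andP[]. Qed.
Next Obligation.
move=> Q r tau tau'; rewrite !inE => /andP[_ /exists_inP[s sQ /sub_commonP st]] tt' ->.
apply/exists_inP; exists s => //; apply/sub_commonP => x p xs pt.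
by apply: st => //; exact: (fintype.subsetP tt').
Qed.

Lemma witness_complex_mono (Q Q' : {set {set X}}) r r' :
  Q \subset Q' -> r <= r' -> witness_complex Q r \subset witness_complex Q' r'.
Proof.
move=> QQ' rr'; apply/fintype.subsetP => tau; rewrite !inE.
move=> /andP[-> /exists_inP[s sQ /sub_commonP st]]; apply/exists_inP; exists s.
  exact: (fintype.subsetP QQ').
by apply/sub_commonP => x p xs pt; apply: near_mono rr' _; exact: st.
Qed.

(* Dowker duality between the points and the simplices in Q. *)
Lemma galois_witness (Q : {set {set X}}) r :
    Q \subset cech X r ->
    (forall F : {set {set X}}, F != finset.set0 -> F \subset Q ->
       finset.cover F \in simplices (cech X r) -> finset.cover F \in Q) ->
  galois (witness_complex Q r) Q (fun s t : {set X} => t \subset s) (points r)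
    (fun tau => finset.cover [set s in Q | s \subset common r tau]%SET).
Proof.
move=> QK Qcover; split=> //.
- by move=> s t u /= ts us; exact: fintype.subset_trans us ts.
- move=> s sQ; rewrite inE; apply/andP; split.
    (* A Čech simplex s, viewed as a point, is near all its vertices; this is why subsets of X
       provide enough points. *)
    apply/finset.set0Pn; exists s; rewrite inE; apply/forall_inP => x xs.
    by apply: near_vertex => //; exact: (fintype.subsetP QK).
  apply/exists_inP; exists s => //; apply/sub_commonP.
  exact/sub_pointsP.
- move=> s t ts; apply/sub_pointsP => x p xt ps.
  by move: ps; rewrite inE => /forall_inP; apply; exact: (fintype.subsetP ts).
- move=> tau; rewrite inE => /andP[t0 /exists_inP[s sQ st]].
  (* The union of F is again in Q, hence the greatest member of Q inside [common r tau]. *)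
  set F := [set s in Q | _]%SET.
  have sF : s \in F by rewrite inE sQ.
  have Fc : finset.cover F \subset common r tau.
    by apply/finset.bigcupsP => u; rewrite inE => /andP[].
  have /finset.set0Pn[x xs] := simplex_neq0 (fintype.subsetP QK s sQ).
  have xF : x \in finset.cover F by apply/finset.bigcupP; exists s.
  have F0 : finset.cover F != finset.set0 by apply/finset.set0Pn; exists x.
  have c0 : common r tau != finset.set0.
    by apply/finset.set0Pn; exists x; exact: (fintype.subsetP Fc).
  split.
  + apply: Qcover; first by apply/finset.set0Pn; exists s.
      by apply/fintype.subsetP => u; rewrite inE => /andP[].
    by apply: simplex_face Fc F0; exact: common_cech.
  + by apply/sub_pointsP; apply/sub_commonP.
  + move=> u uQ /sub_pointsP/sub_commonP ut.
    by apply: finset.bigcup_max (fintype.subxx u); rewrite inE uQ.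
Qed.

(** The degree condition concerns single vertices, so it passes to unions. *)
Lemma degree_cover_closed r (k : R) (F : {set {set X}}) :
  F \subset degree_complex (cech X r) k -> finset.cover F \in simplices (cech X r) ->
  finset.cover F \in simplices (degree_complex (cech X r) k).
Proof.
move=> /fintype.subsetP FD FK; rewrite inE FK; apply/forall_inP => x.
by move=> /finset.bigcupP[s /FD]; rewrite inE => /andP[_ /forall_inP sk] /sk.
Qed.

Lemma large_cover_closed r (k : R) (F : {set {set X}}) :
  F != finset.set0 -> F \subset large_simplices (cech X r) k ->
  finset.cover F \in simplices (cech X r) -> finset.cover F \in large_simplices (cech X r) k.
Proof.
move=> /finset.set0Pn[s sF] /fintype.subsetP/(_ s sF) sD FK; rewrite inE FK /=.
move: sD; rewrite inE => /andP[_ ks]; apply: le_trans ks _; rewrite ler_nat.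
by apply: dimS; exact: finset.bigcup_sup.
Qed.

(* All the neighbours of a vertex x are within 3 r of every point of B(x, r). *)
Lemma degree_witness_large r r' (k k' : R) : k' <= k -> 3 * r <= r' ->
  witness_complex (degree_complex (cech X r) k) r \subset
  witness_complex (large_simplices (cech X r') k') r'.
Proof.
move=> kk' rr'; suff step : witness_complex (degree_complex (cech X r) k) r \subset
    witness_complex (large_simplices (cech X (3 * r)) k) (3 * r).
  apply: fintype.subset_trans step (witness_complex_mono _ rr').
  by apply: large_simplices_mono kk'; exact: cech_mono.
apply/fintype.subsetP => tau; rewrite !inE => /andP[t0 /exists_inP[s]].
rewrite inE => /andP[sK /forall_inP sk] /sub_commonP st; rewrite t0 /=.
have /finset.set0Pn[x xs] := simplex_neq0 sK.
(* The closed neighbourhood of x: since x itself belongs to N, its dimension is the degree of x. *)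
pose N := [set y | [set y; x]%SET \in simplices (cech X r)]%SET.
have xN : x \in N.
  rewrite inE finset.setUid; apply: simplex_face sK _ _; first by rewrite finset.sub1set.
  by apply/finset.set0Pn; exists x; rewrite inE.
have Nt : {in N & tau, forall y p, near p y (3 * r)}.
  by move=> y p; rewrite inE => yx pt; apply: near_triple yx; exact: st.
apply/exists_inP; exists N; last exact/sub_commonP.
rewrite inE; apply/andP; split.
  have /finset.set0Pn[p pt] := t0; apply: (near_cech (p := p)).
    by apply/finset.set0Pn; exists x.
  by move=> y yN; exact: Nt.
apply: le_trans (sk x xs) _; rewrite ler_nat /Defs.dim (cardsD1 x N) xN /=.
by apply/subset_leq_card/fintype.subsetP => y; rewrite !inE.
Qed.

End Witness.

(** * The two bifiltrations and their interleaving *)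

Section Bifiltrations.
Context (R : realType) (Z : metricType R) (X : {fset Z}).
Implicit Types p q : quadrant R.

Definition scale p : R := (val p).2.

Definition threshold p : R := ((val p).1 : R) * #|` X|%:R.

Definition degree_faces p : {set {set X}} := simplices (degree_cech_complex X p).

Definition large_faces p : {set {set X}} :=
  large_simplices (cech X (scale p)) (threshold p).

Definition degree_witness p := witness_complex (degree_faces p) (scale p).

Definition large_witness p := witness_complex (large_faces p) (scale p).

Lemma scale_le p q : (p <= q)%O -> scale p <= scale q.
Proof. by rewrite quadrant_leE => /andP[]. Qed.

Lemma threshold_le p q : (p <= q)%O -> threshold q <= threshold p.
Proof. by rewrite quadrant_leE => /andP[k_le _]; exact: ler_wpM2r. Qed.

Lemma degree_faces_sub p q : (p <= q)%O -> degree_faces p \subset degree_faces q.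
Proof.
move=> pq; apply: degree_complex_mono; last exact: threshold_le.
exact/cech_mono/scale_le.
Qed.

Lemma large_faces_sub p q : (p <= q)%O -> large_faces p \subset large_faces q.
Proof.
move=> pq; apply: large_simplices_mono; last exact: threshold_le.
exact/cech_mono/scale_le.
Qed.

Lemma degree_witness_sub p q : (p <= q)%O -> degree_witness p \subset degree_witness q.
Proof.
by move=> pq; apply: witness_complex_mono; [exact: degree_faces_sub|exact: scale_le].
Qed.

Lemma large_witness_sub p q : (p <= q)%O -> large_witness p \subset large_witness q.
Proof.
by move=> pq; apply: witness_complex_mono; [exact: large_faces_sub|exact: scale_le].
Qed.

Lemma points_sub p q (s : {set X}) : (p <= q)%O -> points (scale p) s \subset points (scale q) s.
Proof.
move=> pq; apply/sub_pointsP => x t xs; rewrite inE => /forall_inP ts.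
exact: near_mono (scale_le pq) (ts x xs).
Qed.

Lemma degree_galois p : galois (degree_witness p) (degree_faces p)
  (fun s t : {set X} => t \subset s) (points (scale p))
  (fun tau => finset.cover [set s in degree_faces p | s \subset @common R Z X (scale p) tau]%SET).
Proof.
apply: galois_witness; first exact: degree_complex_sub.
by move=> F _; exact: degree_cover_closed.
Qed.

Lemma large_galois p : galois (large_witness p) (large_faces p)
  (fun s t : {set X} => t \subset s) (points (scale p))
  (fun tau => finset.cover [set s in large_faces p | s \subset @common R Z X (scale p) tau]%SET).
Proof.
apply: galois_witness; last exact: large_cover_closed.
by apply/fintype.subsetP => s; rewrite inE => /andP[].
Qed.

Lemma degree_witness_mono p q : (p <= q)%O ->
  realization R (degree_witness p) `<=` realization R (degree_witness q).
Proof. by move=> pq; exact/realization_sub/degree_witness_sub. Qed.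

Lemma large_witness_mono p q : (p <= q)%O ->
  realization R (large_witness p) `<=` realization R (large_witness q).
Proof. by move=> pq; exact/realization_sub/large_witness_sub. Qed.

Lemma degree_flag_mono p q : (p <= q)%O ->
  realization R (flag_complex (fun s t : {set X} => t \subset s) (degree_faces p)) `<=`
  realization R (flag_complex (fun s t : {set X} => t \subset s) (degree_faces q)).
Proof.
by move=> pq; exact/realization_sub/flag_complex_mono/degree_faces_sub.
Qed.

(** The zigzag passes through the flags of degree faces: Dowker duality on the side of the
    witnesses, barycentric subdivision on the other. *)
Lemma degree_cech_weakly_equivalent :
  weakly_equivalent R (inclusion_functor degree_witness_mono) (degree_cech X).
Proof.
apply: weakly_equivalent_backward; last first.
  apply: (galois_weak_equivalence _ degree_faces_sub _
    (fun p => galois_faces (degree_cech_complex X p))).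
  - exact: degree_faces_sub.
  - by [].
apply: weakly_equivalent_forward; last first.
  apply: (galois_flag_weak_equivalence (F := fun p => flag_complex
      (fun s t : {set X} => t \subset s) (degree_faces p)) _ _ _
    (fun p => galois_faces (degree_cech_complex X p)) _ degree_flag_mono).
  (* Inclusion and reverse inclusion have the same chains. *)
  by move=> p; apply/setP => F; rewrite !inE chain_rev.
apply: weakly_equivalent_backward; last first.
  apply: (galois_flag_weak_equivalence degree_witness_sub degree_faces_sub _
    degree_galois (fun=> erefl)).
  by move=> p q s pq _; exact: points_sub.
apply: weakly_equivalent_forward; first exact: weakly_equivalent_refl.
exact: galois_weak_equivalence degree_galois _.
Qed.

Lemma subdivision_cech_weakly_equivalent :
  weakly_equivalent R (inclusion_functor large_witness_mono) (subdivision_cech X).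
Proof.
apply: weakly_equivalent_backward; last first.
  apply: (galois_flag_weak_equivalence large_witness_sub large_faces_sub _ large_galois).
  - by move=> p q s pq _; exact: points_sub.
  - by move=> p; exact: subdivision_flag.
apply: weakly_equivalent_forward; first exact: weakly_equivalent_refl.
exact: galois_weak_equivalence large_galois _.
Qed.

(** All these complexes share the vertex type [{set X}], so one functor of inclusions covers both
    sides. *)
Definition interleaving_witness (x : interleaving_category R) :
    simplicial_complex {set X} :=
  if x.2 then large_witness x.1 else degree_witness x.1.

(** The order is written out because [interleaving_category] does not mention the shifts. The four
    cases are the monotonicity of each side and the two comparisons. *)
Lemma interleaving_witness_mono x y :
  interleaving_le (triple_shift R) (id_shift R) x y ->
  realization R (interleaving_witness x) `<=` realization R (interleaving_witness y).
Proof.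
move=> xy; apply: realization_sub.
case: x y xy => [p [|]] [q [|]] /= pq; rewrite /interleaving_witness /=.
- exact: large_witness_sub.
- apply: (fintype.subset_trans (large_witness_sub pq)).
  by apply: witness_complex_mono => //; exact: large_degree_simplices.
- have /andP[k_le r_le] :
      (((val q).1 : R) <= (val p).1) && (3 * (val p).2 <= ((val q).2 : R)) := pq.
  by apply: degree_witness_large => //; exact: ler_wpM2r.
- exact: degree_witness_sub.
Qed.

End Bifiltrations.

Theorem proposition3p4 (R : realType) (Z : metricType R) (Z_good : good Z)
    (X : {fset Z}) (X_neq0 : X != fset0) :
  homotopy_interleaved (triple_shift R) (id_shift R)
    (degree_cech X) (subdivision_cech X).
Proof.
exists (inclusion_functor (@degree_witness_mono R Z X)),
  (inclusion_functor (@large_witness_mono R Z X)); split.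
- exact: degree_cech_weakly_equivalent.
- exact: subdivision_cech_weakly_equivalent.
- refine (ex_intro _ (inclusion_functor (@interleaving_witness_mono R Z X)) _).
  by split; exact: restrict_inclusion_functor.
Qed.
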